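(* Let $G$ be a connected graph and let $\mathcal{D}$ be an $x$-monotone even drawing of $G$. Then there is an $x$-monotone drawing $\mathcal{D}'$ of $G$, equivalent to $\mathcal{D}$, in which no two edges cross each other and in which every vertex of $G$ has the same $x$-coordinate as in $\mathcal{D}$.
   Context: Graphs are finite and simple. A drawing of a graph $G$ is a representation of its vertices by points of the plane $\mathbb{R}^2$ and of its edges by simple Jordan arcs connecting the corresponding point pairs. The arcs may cross each other, subject to the following assumptions: (1) no edge passes through any vertex other than its endpoints; (2) any two edges cross only a finite number of times; (3) no three edges cross at the same point; (4) if two edges share an interior point $p$, then they properly cross at $p$, i.e., one arc passes from one side of the other arc to the other side; (5) no two vertices have the same $x$-coordinate. A drawing is $x$-monotone if every vertical line intersects every edge in at most one point. A drawing is even if any two (distinct) edges cross an even number of times (possibly zero). Two $x$-monotone drawings of the same graph $G$ are equivalent if, in a small neighborhood of each vertex $v\in V(G)$, the relationships ''lies above'' and ''lies below'' between the edges incident to $v$ are the same in both drawings. That is, for each vertex $v$, the same edges leave $v$ to the left (resp. to the right) in both drawings, and the vertical order, near $v$, of the edges leaving $v$ to the left (resp. to the right) is the same in both drawings. *)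

(* Defs.v *)
(** The plane is [R * R] for [R : realType]. *)
From HB Require Import structures.
From mathcomp Require Import all_boot all_order all_algebra.
From mathcomp Require Import finmap.
From mathcomp Require Import all_classical all_reals all_analysis.

Set Implicit Arguments.
Unset Strict Implicit.
Unset Printing Implicit Defensive.

Import Order.TTheory GRing.Theory Num.Theory.
Import numFieldNormedType.Exports.

Local Open Scope ring_scope.
Local Open Scope classical_set_scope.

Record sgraph := SGraph {
  vertex :> finType;
  adj : rel vertex;
  adj_sym : symmetric adj;
  adj_irrefl : irreflexive adj }.

Definition edges (G : sgraph) : {set {set G}} :=
  [set e : {set G} | [exists u, exists v, adj u v && (e == [set u; v])]]%SET.

Definition connected_graph (G : sgraph) : Prop :=
  forall u v : G, connect (@adj G) u v.

(** Arcs are point sets, so that an edge carries no orientation;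
    [arc_param g p q A] says that [g] parametrizes the simple arc [A]
    from [p] to [q]. *)
Definition arc_param (R : realType) (g : R -> R * R) (p q : R * R)
    (A : set (R * R)) : Prop :=
  [/\ {within `[0%R, 1%R], continuous g},
      set_inj `[0%R, 1%R] g,
      g 0 = p, g 1 = q & g @` `[0%R, 1%R] = A].

Definition jordan_arc (R : realType) (p q : R * R) (A : set (R * R)) : Prop :=
  exists g : R -> R * R, arc_param g p q A.

(** [S1] and [S2] are the two sides of the arc [A] in the neighborhood [U] of
    its interior point [p]: being open, connected and disjoint, they are the
    connected components of [U `\` A].  Without the closure conditions, [U]
    could be so large that [A] has the same component of [U `\` A] on both of
    its sides near [p]. *)
Definition local_sides (R : realType) (A : set (R * R)) (p : R * R)
    (U S1 S2 : set (R * R)) : Prop :=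
  [/\ open U /\ U p,
      U `\` A = S1 `|` S2 /\ S1 `&` S2 = set0,
      open S1 /\ connected S1,
      open S2 /\ connected S2
    & closure S1 p /\ closure S2 p].

Definition properly_crosses (R : realType) (B A : set (R * R))
    (p : R * R) : Prop :=
  exists (U S1 S2 : set (R * R)) (a b : R * R) (g : R -> R * R) (t : R),
    [/\ local_sides A p U S1 S2,
        arc_param g a b B,
        0 < t < 1 /\ g t = p,
        \forall s \near t^'-, S1 (g s)
      & \forall s \near t^'+, S2 (g s)].

(** Interior points of the arc [A] drawn for the edge [e], when the vertices
    are placed by [pos]. *)
Definition arc_interior (R : realType) (G : sgraph) (pos : G -> R * R)
    (A : {set G} -> set (R * R)) (e : {set G}) : set (R * R) :=
  A e `\` [set pos v | v in [set` e]].

(** The values of [arc] outside [edges G] are irrelevant. *)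
Record drawing (R : realType) (G : sgraph) := Drawing {
  pos : G -> R * R;
  arc : {set G} -> set (R * R);
  arc_joins : forall u v : G, adj u v ->
    jordan_arc (pos u) (pos v) (arc [set u; v]%SET);
  arc_avoids_vertices : forall (e : {set G}) (v : G),
    e \in edges G -> arc e (pos v) -> v \in e;
  finitely_many_crossings : forall e f : {set G},
    e \in edges G -> f \in edges G -> e != f ->
    finite_set (arc_interior pos arc e `&` arc_interior pos arc f);
  no_triple_crossing : forall e f h : {set G},
    e \in edges G -> f \in edges G -> h \in edges G ->
    e != f -> e != h -> f != h ->
    arc_interior pos arc e `&` arc_interior pos arc f
      `&` arc_interior pos arc h = set0;
  crossings_proper : forall (e f : {set G}) (p : R * R),
    e \in edges G -> f \in edges G -> e != f ->
    arc_interior pos arc e p -> arc_interior pos arc f p ->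
    properly_crosses (arc e) (arc f) p;
  vertex_abscissae_inj : injective (fun v : G => (pos v).1) }.

Section Drawings.
Context {R : realType} {G : sgraph}.
Implicit Types (D : drawing R G) (v : G) (e f : {set G}).

Definition crossings D e f : set (R * R) :=
  arc_interior (pos D) (arc D) e `&` arc_interior (pos D) (arc D) f.

Definition x_monotone D : Prop :=
  forall e, e \in edges G ->
  forall (x y z : R), arc D e (x, y) -> arc D e (x, z) -> y = z.

Definition even_drawing D : Prop :=
  forall e f, e \in edges G -> f \in edges G -> e != f ->
  ~~ odd #|` fset_set (crossings D e f)|.

Definition crossing_free D : Prop :=
  forall e f, e \in edges G -> f \in edges G -> e != f ->
  crossings D e f = set0.

Definition leaves_left D v e : Prop :=
  \forall p \near pos D v, arc D e p -> p <> pos D v -> p.1 < (pos D v).1.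

Definition leaves_right D v e : Prop :=
  \forall p \near pos D v, arc D e p -> p <> pos D v -> (pos D v).1 < p.1.

Definition lies_below D v e f : Prop :=
  \forall p \near pos D v & q \near pos D v,
    arc D e p -> arc D f q -> p <> pos D v -> q <> pos D v ->
    p.1 = q.1 -> p.2 < q.2.

(** [lies_below] is vacuous for two edges leaving [v] on opposite sides, hence
    the restriction to edges leaving on the same side. *)
Definition equivalent_drawings D D' : Prop :=
  (forall v e, e \in edges G -> v \in e ->
     (leaves_left D v e <-> leaves_left D' v e) /\
     (leaves_right D v e <-> leaves_right D' v e)) /\
  (forall v e f, e \in edges G -> f \in edges G -> v \in e -> v \in f ->
     (leaves_left D v e /\ leaves_left D v f) \/
     (leaves_right D v e /\ leaves_right D v f) ->
     (lies_below D v e f <-> lies_below D' v e f)).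

End Drawings.

(* Main.v *)
Require Import Defs.
From mathcomp Require Import all_boot all_order all_algebra.
From mathcomp Require Import finmap.
From mathcomp Require Import all_classical all_reals all_analysis.
From mathcomp Require Import zify ring lra.

(** Read an x-monotone drawing through signs: for two edges whose intervals of
abscissae overlap, which one is lower at the start of the overlap; for an edge
and a vertex strictly inside its interval, on which side the edge passes.
Consecutive proper crossings of two edges swap them, so in an even drawing two
edges are in the same order at both ends of their overlap ([dichotomy], resting
on [cross_sign] and [even_sign]).  Hence the order of [e] and [f] is also the
side of [e] on which any endpoint of [f] interior to the span of [e] lies; this
is the combinatorial notion [even_signs], proved for the drawing in
[even_below].

Conversely, suppose that an even sign pattern is a linear order at the abscissa
of every vertex.  Give each edge, at each vertex abscissa it meets, its rank in
that order as its height, and interpolate with bump functions.  Two edges whose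
heights are weakly ordered at every level, and strictly at each level that is
not a common endpoint, do not meet except at common endpoints ([curve_lt]), so
this is a crossing-free drawing realizing the signs.

The difficulty is that even signs need not be transitive: already for a tree,
three edges over one abscissa may satisfy e < f < g < e.  The signs must be
changed, but never for two edges with a common endpoint, since those signs are
the rotation at the vertices.  This is [level_planar], proved by sweeping the
vertices from left to right.  If the next vertex [v] has an edge to its left,
its position is forced and the order stays linear ([sweep_step],
[level_trans_of_mono]).  Otherwise [v] opens a new piece of the graph, to be
inserted in the linear order of the edges passing over [v].

By connectedness there is a first vertex [rr] to the right of [v] at which the
component of [v] is linked to an edge passing over [v] ([horizon]).  Look at
the components of the graph in the window of abscissae [x v, x rr).  For a
chain [P] modulo 2 without boundary in the window, the parity of the number of
edges of [P] below a moving point does not change as the point travels through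
a component disjoint from [P] ([transport]).  Applied to paths, this says:
edges over [v] of one component lie on the same side of [v]; the edges over [v]
whose component continues to [rr] or beyond are already placed consistently
with the order ([reach_mono]); and a component that does not continue so far
never surrounds one that does ([same_comp_through]).  A component that does not
continue to [rr] has no edge beyond the window, and that of [v] no edge before
it; so the overlaps of their edges begin and end in the window, and all signs
between the two may be reversed at once ([flip_even]).  Reversing them where
needed makes [v] fit in the order ([source_insert]). *)

Set Implicit Arguments.
Unset Strict Implicit.
Unset Printing Implicit Defensive.
Import Order.TTheory GRing.Theory Num.Theory.
Import numFieldNormedType.Exports.
Local Open Scope ring_scope.

(** * Sign patterns and chains modulo 2 *)

Section Levels.
Variables (R : realDomainType) (V E : finType) (l r : E -> V) (x : V -> R).
Hypothesis x_inj : injective x.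
Hypothesis lr : forall e, x (l e) < x (r e).

Definition is_end u e := (u == l e) || (u == r e).
Definition spans e u := x (l e) < x u < x (r e).
Definition overlap e f := (x (l e) < x (r f)) && (x (l f) < x (r e)).
(** Half-open, so that the number of chain edges over an abscissa changes between
[a] and [b] exactly by the endpoints with abscissa at least [a] and less than [b]; [over_diff]
and [transport] rest on this. *)
Definition over e y := x (l e) < y <= x (r e).

(** [s e f] is read: [e] passes below [f] where both are defined; it is meaningless
when the spans do not overlap.  [A e v] is read: [e] passes below the vertex
[v] of its open span.  [sign_end] ties the two readings and encodes evenness,
because it speaks of both endpoints of [f].  [sign_left] and [sign_right] say
that the signs at a vertex come from its rotation. *)
Record even_signs (s : E -> E -> bool) (A : E -> V -> bool) : Prop := {
  sign_irr : forall e, s e e = false;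
  sign_anti : forall e f, e != f -> overlap e f -> s f e = ~~ s e f;
  sign_end : forall e f u, is_end u f -> spans e u -> s e f = A e u;
  sign_left : forall e f g, l e = l f -> l f = l g -> s e f -> s f g -> s e g;
  sign_right : forall e f g, r e = r f -> r f = r g -> s e f -> s f g -> s e g }.

Lemma is_endl e : is_end (l e) e. Proof. by rewrite /is_end eqxx. Qed.
Lemma is_endr e : is_end (r e) e. Proof. by rewrite /is_end eqxx orbT. Qed.

Lemma l_neq_r e : l e != r e.
Proof. by apply/eqP => h; have := lr e; rewrite h ltxx. Qed.

Lemma end_bounds e u (ue : is_end u e) : x (l e) <= x u <= x (r e).
Proof. by have := ltW (lr e); case/orP: ue => /eqP->; rewrite lexx => ->. Qed.

Lemma spans_end_neq e f u : spans e u -> is_end u f -> e != f.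
Proof.
by move=> /andP[h1 h2] /orP[] /eqP eu; apply/eqP => ef; subst; rewrite ltxx in h1 h2.
Qed.

Lemma spans_overlap e f u : spans e u -> is_end u f -> overlap e f.
Proof.
move=> /andP[h1 h2] /end_bounds /andP[h3 h4]; apply/andP; split.
  exact: lt_le_trans h4.
exact: le_lt_trans h2.
Qed.

Section Chains.
Variables (s : E -> E -> bool) (A : E -> V -> bool).
Hypothesis evenS : even_signs s A.
Implicit Types (P Q : E -> bool) (e f q : E) (u w z : V).

Lemma sign_endC e f u : is_end u f -> spans e u -> s f e = ~~ A e u.
Proof.
move=> uf eu; rewrite -(sign_end evenS uf eu).
by apply: (sign_anti evenS); [apply: spans_end_neq uf | apply: spans_overlap uf].
Qed.

(** Modulo 2: [deg P] is the boundary of the chain [P]. *)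
Definition deg (P : E -> bool) z := \big[addb/false]_e (P e && is_end z e).
(** Parity of the number of edges of [P] met by the vertical ray going down from
the point of [q] with abscissa [y]. *)
Definition below_edge (P : E -> bool) q y :=
  \big[addb/false]_e (P e && over e y && s e q).
Definition below_vertex (P : E -> bool) u :=
  \big[addb/false]_e (P e && over e (x u) && A e u).

Lemma big_ends (F : V -> bool) e :
  \big[addb/false]_z (is_end z e && F z) = F (l e) (+) F (r e).
Proof.
rewrite (bigD1 (l e)) //= (bigD1 (r e)) /=; last by rewrite eq_sym l_neq_r.
rewrite is_endl is_endr big1 ?addbF // => z /andP[z1 z2].
by rewrite /is_end (negbTE z1) (negbTE z2).
Qed.

Lemma over_diff e a b : a < b ->
  over e a (+) over e b = (a <= x (l e) < b) (+) (a <= x (r e) < b).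
Proof.
move=> ab; have := lr e; rewrite /over.
by case: (ltP (x (l e)) a) => h1; case: (leP a (x (r e))) => h2;
   case: (ltP (x (l e)) b) => h3; case: (leP b (x (r e))) => h4 //= h5; exfalso; lra.
Qed.

(** The ray going down from a point moving along [q] gains or loses an edge of [P]
in two ways.  Crossing an edge of [P] is invisible, the signs being even; and
each endpoint of [P] passed below [q] changes the count once per incident edge
of [P], that is, an even number of times. *)
Lemma transport P q a b :
  x (l q) <= a -> a < b -> b <= x (r q) ->
  (forall z e, P e -> is_end z e -> a <= x z < b -> z != l q) ->
  (forall z, a <= x z < b -> deg P z = false) ->
  below_edge P q a = below_edge P q b.
Proof.
move=> qa ab bq avoid cyc.
have inner z e : P e -> is_end z e -> a <= x z < b -> spans q z.
  move=> Pe ze zab; have := zab => /andP[az zb].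
  have nz := avoid z e Pe ze zab; rewrite /spans (lt_le_trans zb bq) andbT.
  by rewrite lt_neqAle (inj_eq x_inj) eq_sym nz (le_trans qa az).
suff h : below_edge P q a (+) below_edge P q b = false.
  by move: h; case: (below_edge P q a); case: (below_edge P q b).
rewrite /below_edge -big_split /=.
(* count the lost and gained edges endpoint by endpoint, then exchange the sums *)
rewrite (eq_bigr (fun e => \big[addb/false]_z
   ((P e && is_end z e) && ((a <= x z < b) && ~~ A q z)))); last first.
  move=> e _; case Pe: (P e) => /=; last by rewrite big1.
  rewrite big_ends -andb_addl over_diff //.
  have aux z : is_end z e -> (a <= x z < b) && ~~ A q z = (a <= x z < b) && s e q.
    move=> ze; case zab: (a <= x z < b) => //=.
    by rewrite (sign_endC ze (inner z e Pe ze zab)).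
  by rewrite !aux ?is_endl ?is_endr // -andb_addl.
rewrite exchange_big /= big1 // => z _.
rewrite -big_distrl /=; case zab: (a <= x z < b); last by rewrite andbF.
by rewrite -/(deg P z) cyc.
Qed.

Lemma below_edge_vertex P q u :
  (forall e, P e -> ~~ is_end u e) -> is_end u q ->
  below_edge P q (x u) = below_vertex P u.
Proof.
move=> avoid uq; apply: eq_bigr => e _; case Pe: (P e) => //=.
case oe: (over e (x u)) => //=; apply: (sign_end evenS uq).
move: oe (avoid e Pe) => /andP[h1 h2]; rewrite negb_or => /andP[_ h3].
by rewrite /spans h1 lt_neqAle h2 (inj_eq x_inj) h3.
Qed.

Lemma degD P Q z : deg (fun e => P e (+) Q e) z = deg P z (+) deg Q z.
Proof. by rewrite /deg -big_split /=; apply: eq_bigr => e _; rewrite andb_addl. Qed.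

Lemma below_edgeD P Q q y : below_edge (fun e => P e (+) Q e) q y =
  below_edge P q y (+) below_edge Q q y.
Proof.
by rewrite /below_edge -big_split /=; apply: eq_bigr => e _; rewrite !andb_addl.
Qed.

Lemma deg1 e z : deg (pred1 e) z = is_end z e.
Proof.
rewrite /deg (bigD1 e) //= eqxx big1 ?addbF // => f /negbTE.
by rewrite /= => ->.
Qed.

Lemma below_edge1 e q y : below_edge (pred1 e) q y = over e y && s e q.
Proof.
rewrite /below_edge (bigD1 e) //= eqxx big1 ?addbF // => f /negbTE.
by rewrite /= => ->.
Qed.

Lemma below_edge_none P q y : (forall e, P e -> ~~ over e y) -> below_edge P q y = false.
Proof.
move=> h; apply: big1 => e _; case Pe: (P e) => //=.
by rewrite (negbTE (h e Pe)).
Qed.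

(** * Components in a window of abscissae *)

Section Window.
Variables lo hi : R.

Definition inwin u := lo <= x u < hi.
Definition winadj u w :=
  [&& inwin u, inwin w & [exists e, is_end u e && is_end w e]].
Definition conn := connect winadj.

Lemma winadj_sym : symmetric winadj.
Proof.
move=> u w; rewrite /winadj andbCA; congr [&& _, _ & _].
by apply: eq_existsb => e; rewrite andbC.
Qed.

Lemma conn_sym : symmetric conn.
Proof. exact: sym_connect_sym winadj_sym. Qed.

Lemma conn_ind (Q : V -> Prop) u :
  Q u -> (forall w z, conn u w -> Q w -> winadj w z -> Q z) ->
  forall w, conn u w -> Q w.
Proof.
move=> Qu step w /connectP[p pth ->] {w}.
elim/last_ind: p pth => [|p z IH] //=; rewrite rcons_path last_rcons.
move=> /andP[pth a]; apply: step a; last exact: IH.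
by apply/connectP; exists p.
Qed.

Lemma conn_win u w : inwin u -> conn u w -> inwin w.
Proof. by move=> wu; move: w; apply: conn_ind => // ? ? _ _ /and3P[]. Qed.

Lemma conn_end u w e : conn u w -> inwin u -> is_end w e ->
  forall z, is_end z e -> inwin z -> conn u z.
Proof.
move=> uw wu we z ze wz; apply: (@connect_trans _ winadj w) => //; apply: connect1.
rewrite /winadj wz (conn_win wu uw) /=; apply/existsP; exists e.
by rewrite we.
Qed.

Definition cycle_in P := forall z, inwin z -> deg P z = false.

(** The edges of a path, with boundary its two endpoints. *)
Lemma conn_chain u w : inwin u -> conn u w -> exists P : E -> bool,
  (forall e, P e -> [/\ inwin (l e), inwin (r e) & conn u (l e)]) /\
  (forall z, deg P z = (z == u) (+) (z == w)).
Proof.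
move=> wu; move: w; apply: conn_ind.
  exists xpred0; split=> // z; rewrite addbb /deg big1 //.
move=> w z uw [P [Pin Pdeg]] /and3P[ww wz /existsP[e /andP[we ze]]].
have [<-|wz'] := eqVneq w z; first by exists P.
exists (fun f => P f (+) pred1 e f); split.
  move=> f; rewrite /=; case: (eqVneq f e) => [->|_] /=; last by rewrite addbF => /Pin.
  have [lw rw] : inwin (l e) /\ inwin (r e).
    move: we ze wz'; rewrite /is_end => /orP[] /eqP ? /orP[] /eqP ?; subst => //.
      by rewrite eqxx.
    by rewrite eqxx.
  move=> _; split=> //; apply: conn_end uw wu we _ (is_endl e) lw.
move=> y; rewrite degD deg1 Pdeg -addbA; congr (_ (+) _).
have : is_end y e = (y == w) (+) (y == z).
  move: we ze wz'; rewrite /is_end => /orP[] /eqP ? /orP[] /eqP ?; subst => //.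
  - by rewrite eqxx.
  - move=> h; case: (eqVneq y (l e)) => [->|] //=; by rewrite (negbTE h).
  - move=> h; case: (eqVneq y (l e)) => [->|] //=; rewrite ?addbF //.
    by rewrite eq_sym (negbTE h).
  - by rewrite eqxx.
by move=> ->; case: (y == w); case: (y == z).
Qed.

(** Transport along every edge of a path from [u] to [w]. *)
Lemma below_vertex_conn P u w : inwin u -> conn u w -> cycle_in P ->
  (forall z e, conn u z -> P e -> ~~ is_end z e) ->
  below_vertex P u = below_vertex P w.
Proof.
move=> wu uw cyc avoid; move: w uw; apply: conn_ind => // w z uw -> wz.
have uz := connect_trans uw (connect1 wz).
case/and3P: wz => ww wz /existsP[q /andP[wq zq]].
have {}cyc: forall y, inwin y -> deg P y = false by [].
have [->//|wz'] := eqVneq w z.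
rewrite -(below_edge_vertex (fun e => avoid w e uw) wq).
rewrite -(below_edge_vertex (fun e => avoid z e uz) zq).
have tr : below_edge P q (x (l q)) = below_edge P q (x (r q)).
  have [lw rw] : inwin (l q) /\ inwin (r q).
    move: wq zq wz'; rewrite /is_end => /orP[] /eqP ? /orP[] /eqP ?; subst => //.
      by rewrite eqxx.
    by rewrite eqxx.
  apply: transport => //.
    move=> y e Pe ye _; apply/eqP => yl; move: ye; apply/negP/avoid => //.
    by rewrite yl; apply: conn_end uw wu wq _ (is_endl q) lw.
  move=> y /andP[h1 h2]; apply: cyc; move: lw rw.
  by rewrite /inwin => /andP[? ?] /andP[? ?]; apply/andP; split; lra.
by move: wq zq wz'; rewrite /is_end => /orP[] /eqP ? /orP[] /eqP ?; subst => //.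
Qed.

(** For an edge [f] entering the window from the left: it leaves it on the right
either by itself, or through the edge [a] after a path in the window. *)
Definition reaches f a :=
  ((f == a) && (hi <= x (r f))) ||
  [&& inwin (r f), conn (r f) (l a) & hi <= x (r a)].

Definition avoids P u := forall z e, conn u z -> P e -> ~~ is_end z e.

Lemma vertex_to_right P u a : inwin u -> conn u (l a) -> hi <= x (r a) ->
  cycle_in P -> avoids P u -> below_vertex P u = below_edge P a hi.
Proof.
move=> wu ua ha cyc av; rewrite (below_vertex_conn wu ua) //.
rewrite -(@below_edge_vertex _ a); [|by move=> e; apply: av|exact: is_endl].
have /andP[h1 h2] := conn_win wu ua.
apply: transport => // [y e Pe ye _|y /andP[h3 h4]].
  by apply/eqP => yl; move: (av _ e ua Pe); rewrite -yl ye.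
by apply: cyc; rewrite /inwin (le_trans h1 h3).
Qed.

Lemma left_to_vertex P f : x (l f) < lo -> inwin (r f) ->
  cycle_in P -> avoids P (r f) -> below_edge P f lo = below_vertex P (r f).
Proof.
move=> lf wf cyc av; rewrite -(@below_edge_vertex _ f) ?is_endr //; last first.
  by move=> e; apply: av; apply: connect0.
case/andP: (wf); rewrite le_eqVlt => /predU1P[-> //|h1] h2.
apply: transport => //; first exact: ltW.
  by move=> y e Pe ye /andP[h3 h4]; apply/eqP => yl; subst y; lra.
by move=> y /andP[h3 h4]; apply: cyc; rewrite /inwin h3 (lt_trans h4 h2).
Qed.

Hypothesis lohi : lo < hi.

Lemma left_to_right P f a : x (l f) < lo -> reaches f a ->
  cycle_in P -> (inwin (r f) -> avoids P (r f)) ->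
  below_edge P f lo = below_edge P a hi.
Proof.
move=> lf /orP[/andP[/eqP<- hf]|/and3P[wf fa ha]] cyc av.
  apply: transport => //; first exact: ltW.
  by move=> y e Pe ye /andP[h3 h4]; apply/eqP => yl; subst y; lra.
by rewrite left_to_vertex ?(vertex_to_right wf fa) //; apply: av.
Qed.

(** The path of [f], then the window, then [a]: it crosses the window from left to
right, hence separates it into a part below and a part above. *)
Lemma reach_chain f a : over f lo -> reaches f a ->
  exists P, [/\ cycle_in P,
   forall e u, P e -> is_end u e -> inwin u -> inwin (r f) && conn (r f) u,
   forall q, below_edge P q lo = s f q &
   forall q, below_edge P q hi = s a q].
Proof.
move=> of_ /orP[/andP[/eqP<- hf]|/and3P[wf fa ha]].
  have nw u : is_end u f -> ~~ inwin u.
    move=> /orP[] /eqP ->; case/andP: of_ => h1 h2; apply/negP => /andP[h3 h4]; lra.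
  exists (pred1 f); split.
  - by move=> z wz; rewrite deg1; apply: contraTF wz; apply: nw.
  - by move=> e u /eqP-> /nw/negbTE->.
  - by move=> q; rewrite below_edge1 of_.
  - by move=> q; rewrite below_edge1 /over hf; case/andP: of_ => h1 _; rewrite (lt_trans h1).
have [P [Pin Pdeg]] := conn_chain wf fa.
have wa := conn_win wf fa.
exists (fun e => P e (+) pred1 f e (+) pred1 a e); split.
- move=> z wz; rewrite !degD !deg1 Pdeg /is_end.
  have -> : z == l f = false.
    by apply/eqP => zl; subst z; case/andP: of_ wz => h1 _ /andP[h3 h4]; lra.
  have -> : z == r a = false by apply/eqP => zl; subst z; case/andP: wz => h3 h4; lra.
  by rewrite orbF /=; case: (z == r f); case: (z == l a).
- move=> e u /=; case: (eqVneq e a) => [-> _|_].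
    move=> /orP[] /eqP -> wu; rewrite wf //.
    by exfalso; case/andP: wu => h3 h4; lra.
  rewrite addbF; case: (eqVneq e f) => [-> _|_].
    move=> /orP[] /eqP -> wu; rewrite wf /=; last exact: connect0.
    by exfalso; case/andP: wu => h3 h4; case/andP: of_ => h1 _; lra.
  rewrite addbF => /Pin [wl wr fl] ue wu; rewrite wf.
  exact: conn_end fl wf (is_endl e) _ ue wu.
- move=> q; rewrite !below_edgeD !below_edge1 of_ below_edge_none /=; last first.
    by move=> e /Pin[/andP[h1 _] _ _]; apply/negP => /andP[h2 _]; lra.
  by rewrite /over; case/andP: wa => h1 _; rewrite ltNge h1 /= addbF.
- move=> q; rewrite !below_edgeD !below_edge1 /= below_edge_none /=; last first.
    by move=> e /Pin[_ /andP[_ h1] _]; apply/negP => /andP[_ h2]; lra.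
  case/andP: wf => _ h2; rewrite /over [hi <= x (r f)]leNgt h2 andbF /=.
  by case/andP: wa => _ ->; rewrite ha.
Qed.

(** The path that enters the window by [f1] and comes back by [f2]: it does not
meet the right side, so nothing that reaches this side is enclosed by it. *)
Lemma pair_chain f1 f2 : x (l f1) < lo -> x (l f2) < lo ->
  inwin (r f1) -> conn (r f1) (r f2) ->
  exists P, [/\ cycle_in P,
   forall e u, P e -> is_end u e -> inwin u -> conn (r f1) u,
   forall q, below_edge P q lo = s f1 q (+) s f2 q &
   forall q, below_edge P q hi = false].
Proof.
move=> lf1 lf2 w1 c12; have w2 := conn_win w1 c12.
have [P [Pin Pdeg]] := conn_chain w1 c12.
have o1 : over f1 lo by rewrite /over lf1; case/andP: w1.
have o2 : over f2 lo by rewrite /over lf2; case/andP: w2.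
exists (fun e => P e (+) pred1 f1 e (+) pred1 f2 e); split.
- move=> z wz; rewrite !degD !deg1 Pdeg /is_end.
  have lz f : x (l f) < lo -> z == l f = false.
    by move=> lf; apply/eqP => zl; subst z; case/andP: wz => h3 h4; lra.
  by rewrite !lz //=; case: (z == r f1); case: (z == r f2).
- move=> e u /=.
  case: (eqVneq e f2) => [-> _|_].
    by move=> /orP[] /eqP -> // /andP[h3 h4]; exfalso; lra.
  rewrite addbF; case: (eqVneq e f1) => [-> _|_].
    move=> /orP[] /eqP ->; last by move=> _; exact: connect0.
    by move=> /andP[h3 h4]; exfalso; lra.
  by rewrite addbF => /Pin [wl wr fl] ue wu; exact: conn_end fl w1 (is_endl e) _ ue wu.
- move=> q; rewrite !below_edgeD !below_edge1 o1 o2 below_edge_none //=.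
  by move=> e /Pin[/andP[h1 _] _ _]; apply/negP => /andP[h2 _]; lra.
- move=> q; apply: below_edge_none => e; apply: contraTN => /andP[_ h] /=.
  have -> : e == f1 = false.
    by apply/eqP => ef; subst e; case/andP: w1 => _ h1; lra.
  have -> : e == f2 = false.
    by apply/eqP => ef; subst e; case/andP: w2 => _ h1; lra.
  rewrite !addbF; apply/negP => /Pin[_ /andP[_ h1] _]; lra.
Qed.
End Window.

(** * Reversing all signs between two components *)

Section Flip.
Variables (lo hi : R) (X Y : V -> bool).
Let touches (Z : V -> bool) e := Z (l e) || Z (r e).
Hypothesis X_win : forall u, X u -> inwin lo hi u.
Hypothesis Y_win : forall u, Y u -> inwin lo hi u.
Hypothesis XY : forall u, X u -> ~~ Y u.
Hypothesis X_closed : forall e, touches X e -> X (r e) /\ (X (l e) \/ x (l e) < lo).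
Hypothesis Y_closed : forall e, touches Y e -> Y (l e) /\ (Y (r e) \/ hi <= x (r e)).

Definition flip_s e f :=
  s e f (+) (touches X e && touches Y f || touches Y e && touches X f).
Definition flip_A e u := A e u (+) (touches X e && Y u || touches Y e && X u).

Let no_common_end e f : l e = l f \/ r e = r f -> touches X e -> ~~ touches Y f.
Proof.
move=> ef /X_closed[Xr Xl]; apply/negP => /Y_closed[Yl Yr].
case: ef => ef; rewrite -ef in Yl Yr.
  case: Xl => [/XY|lt_lo]; first by rewrite Yl.
  by have /andP[] := Y_win Yl; rewrite leNgt lt_lo.
case: Yr => [Yr|ge_hi]; first by move: (XY Xr); rewrite Yr.
by have /andP[] := X_win Xr; rewrite ltNge ge_hi.
Qed.

(** The two components have no vertex in common, and their edges leave the window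
on opposite sides. *)
Lemma flip_common_end e f : l e = l f \/ r e = r f -> flip_s e f = s e f.
Proof.
move=> ef; rewrite /flip_s.
have fe : l f = l e \/ r f = r e by case: ef => ->; [left|right].
case Xe: (touches X e).
  rewrite (negbTE (no_common_end ef Xe)) /=.
  have /negbTE-> : ~~ touches Y e by apply: no_common_end Xe; left.
  by rewrite addbF.
case Xf: (touches X f); rewrite ?andbF ?addbF //=.
by rewrite (negbTE (no_common_end fe Xf)) addbF.
Qed.

(** Where an edge of one component overlaps an edge of the other, the overlap
begins and ends at vertices of the components.  So the signs that are reversed
together are exactly those which [sign_end] compares. *)
Lemma flip_even : even_signs flip_s flip_A.
Proof.
split.
- by move=> e; rewrite flip_common_end ?(sign_irr evenS) //; left.
- move=> e f ef ov; rewrite /flip_s (sign_anti evenS ef ov) orbC.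
  by rewrite [touches X f && _]andbC [touches Y f && _]andbC -addNb.
- move=> e f u uf eu; rewrite /flip_s /flip_A (sign_end evenS uf eu).
  case/andP: eu => eu1 eu2; congr (_ (+) (_ || _)).
    case Xe: (touches X e) => //=; have [/X_win/andP[_ h] _] := X_closed Xe.
    apply/idP/idP => [/Y_closed[Yl Yr]|Yu]; last first.
      by rewrite /touches; case/orP: uf => /eqP <-; rewrite Yu ?orbT.
    by case/orP: uf => /eqP ?; subst u => //; case: Yr => // ?; exfalso; lra.
  case Ye: (touches Y e) => //=; have [/Y_win/andP[h _] _] := Y_closed Ye.
  apply/idP/idP => [/X_closed[Xr Xl]|Xu]; last first.
    by rewrite /touches; case/orP: uf => /eqP <-; rewrite Xu ?orbT.
  by case/orP: uf => /eqP ?; subst u => //; case: Xl => // ?; exfalso; lra.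
- move=> e f q ef fq; rewrite (@flip_common_end e f) ?(@flip_common_end f q) ?(@flip_common_end e q);
    by [exact: (sign_left evenS)|left; rewrite ?ef].
- move=> e f q ef fq; rewrite (@flip_common_end e f) ?(@flip_common_end f q) ?(@flip_common_end e q);
    by [exact: (sign_right evenS)|right; rewrite ?ef].
Qed.
End Flip.

(** * Inserting a vertex without left edges *)

Section Source.
Variables v rr : V.
Hypothesis v_lt_rr : x v < x rr.
Hypothesis left_trans : forall e f q, spans e v -> spans f v -> spans q v ->
  s e f -> s f q -> s e q.
Let lo := x v.
Let hi := x rr.
Let win := inwin lo hi.
Let cn := conn lo hi.
Hypothesis isolated : forall f, spans f v -> ~~ cn v (r f).
Variables (b f0 a0 : E).
Hypothesis cn_b : cn v (l b).
Hypothesis r_b : r b = rr.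
Hypothesis f0_v : spans f0 v.
Hypothesis f0_a0 : reaches lo hi f0 a0.
Hypothesis r_a0 : r a0 = rr.
Variable g : E.
Hypothesis l_g : l g = v.
Hypothesis no_left : forall e, r e != v.

Definition same_comp f f' := win (r f) && cn (r f) (r f').

Let win_v : win v. Proof. by rewrite /win /inwin lexx. Qed.

Let over_v f : spans f v -> over f lo.
Proof. by move=> /andP[h1 h2]; rewrite /over h1 ltW. Qed.

Let sg f : spans f v -> s f g = A f v.
Proof. by move=> fv; apply: (sign_end evenS) => //; rewrite -l_g is_endl. Qed.

(** The component of [v] touches the left side of the window at [v] alone; any edge
[g] leaving [v] stands for the starting point of a ray from [v]. *)
Lemma source_to_right P : cycle_in lo hi P -> avoids lo hi P v ->
  below_edge P g lo = below_edge P b hi.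
Proof.
move=> cyc av; rewrite (@below_edge_vertex _ _ v); first last.
- by rewrite -l_g is_endl.
- by move=> e; apply: av; apply: connect0.
by rewrite (vertex_to_right win_v cn_b) // r_b.
Qed.

(** The component of [v] reaches the right side, which the path entering by [f1] and
returning by [f2] does not; so it does not pass between [f1] and [f2]. *)
Lemma same_comp_source f1 f2 : spans f1 v -> spans f2 v -> same_comp f1 f2 ->
  A f1 v = A f2 v.
Proof.
move=> v1 v2 /andP[w1 c12].
have [P [cyc Pconn Plo Phi]] := pair_chain (proj1 (andP v1)) (proj1 (andP v2)) w1 c12.
have av : avoids lo hi P v.
  move=> z e vz Pe; apply: contraNN (isolated v1) => ze.
  have wz := conn_win win_v vz.
  by apply: connect_trans vz _; rewrite [connect _ _ _]conn_sym; apply: Pconn ze wz.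
move: (source_to_right cyc av); rewrite Plo Phi !sg //.
by case: (A f1 v); case: (A f2 v).
Qed.

(** The same argument as for [same_comp_source], for a component entering by [f]. *)
Lemma same_comp_through f1 f2 f a : spans f1 v -> spans f2 v -> spans f v ->
  same_comp f1 f2 -> reaches lo hi f a -> ~~ same_comp f1 f -> s f1 f = s f2 f.
Proof.
move=> v1 v2 vf /andP[w1 c12] fa nc.
have [P [cyc Pconn Plo Phi]] := pair_chain (proj1 (andP v1)) (proj1 (andP v2)) w1 c12.
have av : win (r f) -> avoids lo hi P (r f).
  move=> wf z e fz Pe; apply: contraNN nc => ze; rewrite /same_comp w1 /=.
  have wz := conn_win wf fz.
  by apply: connect_trans (Pconn _ _ Pe ze wz) _; rewrite [connect _ _ _]conn_sym.
move: (left_to_right v_lt_rr (proj1 (andP vf)) fa cyc av); rewrite Plo Phi.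
by case: (s f1 f); case: (s f2 f).
Qed.

(** A path crossing the window has [v] on one side, and the edge [b] by which the
component of [v] arrives at [rr] on the same side. *)
Lemma reach_source f a : spans f v -> reaches lo hi f a -> A f v = s a b.
Proof.
move=> vf fa; have [P [cyc Pconn Plo Phi]] := reach_chain v_lt_rr (over_v vf) fa.
rewrite -sg // -Plo -Phi; apply: source_to_right cyc _.
move=> z e vz Pe; apply: contraNN (isolated vf) => ze.
have wz := conn_win win_v vz.
have /andP[wf fz] := Pconn _ _ Pe ze wz.
by apply: connect_trans vz _; rewrite [connect _ _ _]conn_sym.
Qed.

(** Two disjoint components that cross the window do so in the same order on both
sides. *)
Lemma reach_order f f' a a' : spans f v -> spans f' v ->
  reaches lo hi f a -> reaches lo hi f' a' -> ~~ same_comp f f' -> s f f' = s a a'.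
Proof.
move=> vf vf' fa fa' nc.
have [P [cyc Pconn Plo Phi]] := reach_chain v_lt_rr (over_v vf) fa.
rewrite -Plo -Phi; apply: (left_to_right v_lt_rr (proj1 (andP vf')) fa' cyc).
move=> wf' z e fz Pe; apply: contraNN nc => ze.
have wz := conn_win wf' fz.
have /andP[wf fz'] := Pconn _ _ Pe ze wz; rewrite /same_comp [win _]wf /=.
by apply: connect_trans fz' _; rewrite [connect _ _ _]conn_sym.
Qed.

Lemma same_comp_sym f f' : same_comp f f' = same_comp f' f.
Proof.
suff h q q' : same_comp q q' -> same_comp q' q by apply/idP/idP; apply: h.
move=> /andP[wq qq']; rewrite /same_comp [win _](conn_win wq qq') /=.
by rewrite /cn conn_sym.
Qed.

(** In the component of [f0] the exit edge can be taken to be [a0], so an exit edge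
that passes over [rr] belongs to a component other than that of [f0]. *)
Lemma reach_end_rr f a : spans f v -> reaches lo hi f a ->
  exists2 a', reaches lo hi f a' & same_comp f f0 -> r a' = rr.
Proof.
move=> vf fa; case c: (same_comp f f0); last by exists a.
exists a0 => //; case/andP: c => wf cf; move: f0_a0 => /orP[/andP[_ h]|/and3P[w0 c0 h]].
  by move: (conn_win wf cf) => /andP[_]; rewrite ltNge h.
have c: conn lo hi (r f) (l a0) by apply: connect_trans cf c0.
by rewrite /reaches [inwin _ _ _]wf c h orbT.
Qed.

Let spans_rr f a : spans f v -> reaches lo hi f a -> r a != rr -> spans a rr.
Proof.
move=> fv fa na; have : x (l a) < hi /\ hi <= x (r a).
  case/orP: fa => [/andP[/eqP<- h]|/and3P[w c h]].
    by split=> //; case/andP: fv => h1 _; apply: lt_trans v_lt_rr.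
  by split=> //; case/andP: (conn_win w c).
case=> h1 h2; rewrite /spans h1 lt_neqAle h2 andbT.
by rewrite (inj_eq x_inj) eq_sym.
Qed.

(** Transfer a counterexample to the right side of the window: the exit edges would
satisfy a < a' < b < a.  If one of them ends at [rr] this contradicts the
rotation at [rr] or the side of [rr] on which the other passes.  If both pass
over [rr], comparing them there with [a0], which ends at [rr] like [b], gives
a < a' < a0 < a, and going back to the left side f < f' < f0 < f, against the
linear order of the edges over [v]. *)
Lemma reach_mono f f' a a' : spans f v -> spans f' v ->
  reaches lo hi f a -> reaches lo hi f' a' -> s f f' -> A f' v -> A f v.
Proof.
move=> vf vf' fa fa' ff' Af'; apply/negPn/negP => nAf.
have nc : ~~ same_comp f f'.
  by apply: contraNN nAf => c; rewrite (same_comp_source vf vf' c).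
have {a fa} [a fa ar] := reach_end_rr vf fa.
have {a' fa'} [a' fa' ar'] := reach_end_rr vf' fa'.
have sab := reach_source vf fa; have sab' := reach_source vf' fa'.
have saa := reach_order vf vf' fa fa' nc.
move: nAf Af' ff'; rewrite sab sab' saa => nab ab' aa'.
have [rb ra0] : is_end rr b /\ is_end rr a0 by rewrite -r_b is_endr r_b -r_a0 is_endr.
have xa := spans_rr vf fa; have xa' := spans_rr vf' fa'.
have [ra|ra] := eqVneq (r a) rr; have [ra'|ra'] := eqVneq (r a') rr.
- by move: nab; rewrite (sign_right evenS _ _ aa' ab') // ?ra ?ra' ?r_b.
- have era : is_end rr a by rewrite -ra is_endr.
  move: aa'; rewrite (sign_endC era (xa' ra')).
  by rewrite -(sign_end evenS rb (xa' ra')) ab'.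
- have era : is_end rr a' by rewrite -ra' is_endr.
  move: aa'; rewrite (sign_end evenS era (xa ra)).
  by rewrite -(sign_end evenS rb (xa ra)) (negbTE nab).
have c1 : ~~ same_comp f f0 by apply: contraNN ra => /ar ->.
have c2 : ~~ same_comp f' f0 by apply: contraNN ra' => /ar' ->.
move: nab; rewrite (sign_end evenS rb (xa ra)) -(sign_end evenS ra0 (xa ra)).
rewrite -(reach_order vf f0_v fa f0_a0 c1) (left_trans vf vf' f0_v) //.
  by rewrite (reach_order vf vf' fa fa').
rewrite (reach_order vf' f0_v fa' f0_a0 c2).
by rewrite (sign_end evenS ra0 (xa' ra')) -(sign_end evenS rb (xa' ra')).
Qed.

Let stubbed f := [exists a, reaches lo hi f a].

Let target f :=
  [exists f', [&& spans f' v, stubbed f', A f' v & (f' == f) || s f f']].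

Let wrong u := win u && [exists f,
  [&& spans f v, win (r f), ~~ stubbed f, cn (r f) u & A f v != target f]].

Let cn_sym u w : cn u w -> cn w u.
Proof. by rewrite /cn conn_sym. Qed.

Let stubbed_conn f a : win (r f) -> cn (r f) (l a) -> hi <= x (r a) -> stubbed f.
Proof.
move=> w c h; apply/existsP; exists a.
by rewrite /reaches [inwin _ _ _]w [conn _ _ _ _]c h orbT.
Qed.

Let same_comp_stubbed f1 f2 : same_comp f1 f2 -> stubbed f2 -> stubbed f1.
Proof.
move=> /andP[w1 c12] /existsP[a /orP[/andP[_ h]|/and3P[w2 c h]]].
  by case/andP: (conn_win w1 c12) => _; rewrite ltNge h.
by apply: stubbed_conn h => //; apply: connect_trans c12 c.
Qed.

Let same_comp_target f1 f2 : spans f1 v -> spans f2 v -> same_comp f1 f2 ->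
  ~~ stubbed f1 -> target f1 = target f2.
Proof.
have sub q q' : spans q v -> spans q' v -> same_comp q q' -> ~~ stubbed q ->
    target q -> target q'.
  move=> vq vq' qq' nq /existsP[f /and4P[vf sf Af /predU1P[fq|qf]]].
    by subst f; rewrite sf in nq.
  apply/existsP; exists f; rewrite vf sf Af /=; apply/orP; right.
  case/existsP: (sf) => a fa; rewrite -(same_comp_through vq vq' vf qq' fa) //.
  by apply: contraNN nq => /same_comp_stubbed; apply.
move=> v1 v2 c n1; apply/idP/idP; apply: sub => //; first by rewrite same_comp_sym.
by apply: contraNN n1; apply: same_comp_stubbed.
Qed.

Let stubbed_target f : spans f v -> stubbed f -> target f = A f v.
Proof.
move=> vf sf; apply/idP/idP => [/existsP[f' /and4P[vf' sf' Af]]|Af].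
  case/predU1P => [<-//|ff']; case/existsP: sf => a fa; case/existsP: sf' => a' fa'.
  exact: reach_mono vf vf' fa fa' ff' Af.
by apply/existsP; exists f; rewrite vf sf Af eqxx.
Qed.

Let wrong_right f : spans f v -> wrong (r f) = (A f v != target f).
Proof.
move=> vf; apply/idP/idP.
  move=> /andP[wf /existsP[f1 /and5P[v1 w1 n1 c1 d1]]].
  have c : same_comp f1 f by apply/andP.
  by rewrite -(same_comp_source v1 vf c) -(same_comp_target v1 vf c n1).
move=> d; have nf : ~~ stubbed f.
  by apply: contraNN d => sf; rewrite stubbed_target.
have wf : win (r f).
  case/andP: vf => h1 h2; rewrite /win /inwin ltW //= ltNge.
  apply: contraNN nf => h; apply/existsP; exists f.
  by rewrite /reaches eqxx h.
rewrite /wrong wf; apply/existsP; exists f; rewrite vf wf nf d andbT.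
by rewrite /cn /conn connect0.
Qed.

(** Place [v] just above all the edges, already below it, whose component crosses
the window.  The edges on the wrong side of this position all lie in components
that do not cross the window, each of them entirely on one side of it; reverse
the signs between these and the component of [v]. *)
Lemma source_insert : exists s' A',
  [/\ even_signs s' A',
    forall e f, l e = l f \/ r e = r f -> s' e f = s e f,
    forall e f, x (l e) < x v -> x (l f) < x v -> s' e f = s e f,
    forall e u, x u < x v -> A' e u = A e u &
    forall e f, spans e v -> spans f v -> s' e f -> A' f v -> A' e v].
Proof.
have Xwin u : wrong u -> inwin lo hi u by case/andP.
have Ywin u : cn v u -> inwin lo hi u by apply: conn_win.
have XY u : wrong u -> ~~ cn v u.
  move=> /andP[_ /existsP[f /and5P[vf _ _ fu _]]].
  apply: contraNN (isolated vf) => vu; apply: connect_trans vu _.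
  exact: cn_sym.
have Xcl e : wrong (l e) || wrong (r e) -> wrong (r e) /\ (wrong (l e) \/ x (l e) < lo).
  have step u z : wrong u -> is_end u e -> is_end z e -> win z -> wrong z.
    move=> /andP[wu /existsP[f /and5P[vf wf nf fu d]]] ue ze wz.
    rewrite /wrong wz; apply/existsP; exists f; rewrite vf wf nf d andbT /=.
    exact: conn_end fu wf ue _ ze wz.
  case/orP => [Xl|Xr]; last first.
    split=> //; case: (ltP (x (l e)) lo) => h; [by right|left].
    apply: (step (r e)); rewrite ?is_endl ?is_endr // /win /inwin h /=.
    by apply: lt_trans (lr e) _; case/andP: (Xwin _ Xr).
  split; last by left.
  apply: (step (l e)); rewrite ?is_endl ?is_endr //.
  case/andP: (Xl) => /andP[h1 h2] /existsP[f /and5P[vf wf nf fu d]].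
  rewrite /win /inwin (le_trans h1 (ltW (lr e))) /= ltNge.
  by apply: contraNN nf; apply: stubbed_conn.
have Ycl e : cn v (l e) || cn v (r e) -> cn v (l e) /\ (cn v (r e) \/ hi <= x (r e)).
  case/orP => [Yl|Yr].
    split=> //; case: (leP hi (x (r e))) => h; [by right|left].
    apply: (conn_end Yl win_v (is_endl e) (is_endr e)).
    by rewrite /inwin h andbT; apply: le_trans (ltW (lr e)); case/andP: (Ywin _ Yl).
  split; last by left.
  apply: (conn_end Yr win_v (is_endr e) (is_endl e)).
  case/andP: (Ywin _ Yr) => h1 h2; rewrite /inwin (lt_trans (lr e) h2) andbT leNgt.
  apply/negP => h; move: (Yr); apply/negP/isolated.
  by rewrite /spans h lt_neqAle (inj_eq x_inj) eq_sym no_left.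
have early (Z : V -> bool) u : (forall u, Z u -> inwin lo hi u) -> x u < x v -> Z u = false.
  by move=> Zwin h; apply/negP => /Zwin/andP[]; rewrite leNgt h.
(* [wrong] is the union of the components to be reversed against that of [v] *)
exists (flip_s wrong (cn v)), (flip_A wrong (cn v)); split.
- exact: flip_even Xwin Ywin XY Xcl Ycl.
- exact: flip_common_end Xwin Ywin XY Xcl Ycl.
- move=> e f le lf; rewrite /flip_s (early wrong _ Xwin le) (early wrong _ Xwin lf).
  rewrite (early (cn v) _ Ywin le) (early (cn v) _ Ywin lf) /=.
  have nY q : x (l q) < x v -> cn v (r q) = false.
    move=> lq; apply/negP => c; have [|c' _] := Ycl q; first by rewrite c orbT.
    by move: c'; rewrite (early (cn v) _ Ywin lq).
  by rewrite !nY // andbF addbF.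
- move=> e u h; rewrite /flip_A (early wrong _ Xwin h) (early (cn v) _ Ywin h).
  by rewrite !andbF addbF.
have AT e : spans e v -> flip_A wrong (cn v) e v = target e.
  move=> ve; have le : x (l e) < x v by case/andP: ve.
  rewrite /flip_A (early wrong _ Xwin le) (early (cn v) _ Ywin le) /=.
  have cvv : cn v v by exact: connect0.
  rewrite (negbTE (isolated ve)) orbF cvv andbT.
  by rewrite wrong_right //; case: (A e v); case: (target e).
move=> e f ve vf; rewrite !AT //.
have -> : flip_s wrong (cn v) e f = s e f.
  have le : x (l e) < x v by case/andP: ve.
  have lf : x (l f) < x v by case/andP: vf.
  rewrite /flip_s (early wrong _ Xwin le) (early wrong _ Xwin lf).
  rewrite (early (cn v) _ Ywin le) (early (cn v) _ Ywin lf) /=.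
  by rewrite !(negbTE (isolated _)) // andbF addbF.
move=> ef /existsP[f' /and4P[vf' sf' Af' h]].
apply/existsP; exists f'; rewrite vf' sf' Af' /=; apply/orP; right.
by case/predU1P: h => [->//|]; apply: left_trans ve vf vf' ef.
Qed.
End Source.

(** * The sweep *)

Definition edge_adj u w := [exists e, is_end u e && is_end w e].
Hypothesis connected : forall u w, connect edge_adj u w.

Section Horizon.
Variable v : V.
Hypothesis no_left : forall e, r e != v.

Let meets_left y := [exists f, spans f v && conn (x v) y v (r f)].

Let total_meets y f : spans f v -> (forall u, x u < y) -> meets_left y.
Proof.
move=> vf top; apply: contraT; rewrite /meets_left => /existsPn no.
have w0 : inwin (x v) y v by rewrite /inwin lexx top.
suff cl w : conn (x v) y v w.
  have /andP[h _] := conn_win w0 (cl (l f)).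
  by case/andP: vf => h1 _; move: h1; rewrite ltNge h.
have /connectP[p pth ->] := connected v w.
elim/last_ind: p pth => [|p z IH]; first by move=> _; exact: connect0.
rewrite rcons_path last_rcons => /andP[/IH c /existsP[e /andP[ue ze]]].
have wu := conn_win w0 c.
apply: (conn_end c w0 ue ze); rewrite /inwin top andbT leNgt.
apply/negP => hz; have le : z = l e.
  case/orP: ze => /eqP // zr; case/andP: wu => h1 _.
  by have /andP[_ h2] := end_bounds ue; move: hz; rewrite zr ltNge (le_trans h1 h2).
have ur : last v p = r e.
  by case/orP: ue => /eqP // ul; move: hz; case/andP: wu; rewrite ul -le leNgt => /negbTE->.
have := no e; rewrite negb_and -ur c orbF => /negP; apply.
rewrite /spans -ur -le hz lt_neqAle (inj_eq x_inj).
by case/andP: wu => -> _; rewrite andbT ur eq_sym no_left.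
Qed.

(** Take [rr] as the rightmost vertex such that before [rr] the component of [v] has
no edge over [v].  Once [rr] itself is allowed this fails, so [rr] is adjacent
to the component of [v] and to one that contains an edge over [v], or is itself
the end of such an edge. *)
Lemma horizon f : spans f v -> exists rr b f0 a0,
  [/\ x v < x rr, forall f, spans f v -> ~~ conn (x v) (x rr) v (r f),
      conn (x v) (x rr) v (l b) /\ r b = rr, spans f0 v &
      reaches (x v) (x rr) f0 a0 /\ r a0 = rr].
Proof.
move=> vf.
have not_v : ~~ meets_left (x v).
  rewrite /meets_left; apply/existsPn => q; rewrite negb_and; case qv: (spans q v) => //=.
  have : forall w, conn (x v) (x v) v w -> w = v.
    by apply: conn_ind => // ? ? _ _ /and3P[/andP[h1 h2]]; exfalso; lra.
  by move=> h; apply/negP => /h rv; move: (no_left q); rewrite rv eqxx.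
(* the window ending at [rr] is the last one with no edge over [v] in the component of [v] *)
case: (Order.TotalTheory.arg_maxP (P := fun u => ~~ meets_left (x u)) x not_v).
move=> rr nrr max0.
have max u : ~~ meets_left (x u) -> x u <= x rr by exact: max0.
(* the window up to [y] has [rr] as its last vertex *)
have [y [ry yr /existsP[f1 /andP[vf1 cf1]]]] : exists y,
    [/\ x rr < y, forall u, x u < y -> x u <= x rr & meets_left y].
  case: (pickP (fun u => x rr < x u)) => [u0 hu0|top]; last first.
    exists (x rr + 1); split; first by lra.
      by move=> u _; rewrite leNgt top.
    by apply: (total_meets vf) => u; rewrite (le_lt_trans (y := x rr)) ?ltrDl // leNgt top.
  case: (Order.TotalTheory.arg_minP (P := fun u => x rr < x u) x hu0) => n hn min.
  exists (x n); split=> //.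
    by move=> u un; rewrite leNgt; apply/negP => /min; rewrite leNgt un.
  by apply: contraT => /max; rewrite leNgt hn.
have w0 : inwin (x v) y v by rewrite /inwin lexx (le_lt_trans (max v not_v)).
have isol q : spans q v -> ~~ conn (x v) (x rr) v (r q).
  by move=> qv; move: nrr; rewrite /meets_left => /existsPn /(_ q); rewrite qv.
have v_rr : x v < x rr.
  rewrite lt_neqAle max // andbT (inj_eq x_inj).
  apply/eqP => vr; suff : forall w, conn (x v) y v w -> w = v.
    by move=> /(_ _ cf1) h; move: (no_left f1); rewrite h eqxx.
  apply: conn_ind => // w z _ _ /and3P[_ /andP[h1 h2] _].
  by apply: x_inj; apply: le_anti; rewrite h1 vr yr.
have w1 : inwin (x v) (x rr) v by rewrite /inwin lexx.
have low z : inwin (x v) y z -> z != rr -> inwin (x v) (x rr) z.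
  by move=> /andP[h1 /yr h2] zr; rewrite /inwin h1 lt_neqAle h2 (inj_eq x_inj) zr.
have to_rr w e : inwin (x v) (x rr) w -> is_end w e -> is_end rr e -> w = l e /\ r e = rr.
  move=> /andP[_ h] we re; have := lr e; case/orP: we => /eqP we; case/orP: re => /eqP re.
  - by rewrite we re ltxx in h.
  - by [].
  - by rewrite -we -re => h'; have := lt_trans h h'; rewrite ltxx.
  - by rewrite we re ltxx in h.
have [b [cb rb]] : exists b, conn (x v) (x rr) v (l b) /\ r b = rr.
  case: (pickP (fun b => conn (x v) (x rr) v (l b) && (r b == rr))) => [b /andP[cb /eqP rb]|nb].
    by exists b.
  exfalso; have := isol f1 vf1; apply/negP/negPn; move: (r f1) cf1.
  apply: conn_ind => [|w z _ cw /and3P[_ wz /existsP[e /andP[we ze]]]]; first exact: connect0.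
  have [zr|zr] := eqVneq z rr; last by apply: (conn_end cw w1 we ze); apply: low.
  subst z; have [wl re] := to_rr w e (conn_win w1 cw) we ze.
  by have := nb e; rewrite -wl cw re eqxx.
case: (pickP (fun fa => [&& spans fa.1 v, reaches (x v) (x rr) fa.1 fa.2 & r fa.2 == rr])).
  by move=> [f0 a0] /= /and3P[vf0 fa /eqP ra]; exists rr, b, f0, a0.
move=> na; exfalso.
have start : inwin (x v) y (r f1) by apply: conn_win cf1.
have fin w : conn (x v) y (r f1) w -> w != rr /\
    exists q, [/\ spans q v, inwin (x v) (x rr) (r q) & conn (x v) (x rr) (r q) w].
  move: w; apply: conn_ind.
    have rf : r f1 != rr.
      apply/eqP => rf; have := na (f1, f1).
      by rewrite /= vf1 /reaches eqxx rf lexx eqxx.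
    by split=> //; exists f1; split=> //; [apply: low|apply: connect0].
  move=> w z _ [_ [q [vq wq qw]]] /and3P[_ wz /existsP[e /andP[we ze]]].
  have zr : z != rr.
    apply/eqP => zr; subst z; have [wl re] := to_rr w e (conn_win wq qw) we ze.
    by have := na (q, e); rewrite /= vq /reaches wq -wl qw re lexx eqxx orbT.
  by split=> //; exists q; split=> //; apply: (conn_end qw wq we ze); apply: low.
case: (fin v) => [|_ [q [vq wq qv]]]; first by rewrite conn_sym.
by move: (isol q vq); rewrite conn_sym qv.
Qed.
End Horizon.

(** Just to the right of [v] the signs define a linear order. *)
Definition level_trans v := forall e f q,
  x (l e) <= x v < x (r e) -> x (l f) <= x v < x (r f) -> x (l q) <= x v < x (r q) ->
  s e f -> s f q -> s e q.
Definition level_mono v := forall e f,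
  spans e v -> spans f v -> s e f -> A f v -> A e v.

(** Passing [v], its left edges are replaced by its right edges, and these form an
interval of the order because all of them compare with the edges over [v] as
[v] does. *)
Lemma level_trans_of_mono v :
  (forall e f q, spans e v -> spans f v -> spans q v -> s e f -> s f q -> s e q) ->
  level_mono v -> level_trans v.
Proof.
move=> tr mono e f q.
have cs h : x (l h) <= x v < x (r h) -> l h = v \/ spans h v.
  rewrite le_eqVlt => /andP[/predU1P[/x_inj->|h1] h2]; [by left|right].
  by rewrite /spans h1.
have isl h : l h = v -> is_end v h by move=> <-; apply: is_endl.
move=> /cs[e_v|e_v] /cs[f_v|f_v] /cs[q_v|q_v].
- by apply: (sign_left evenS); rewrite ?e_v ?f_v.
- by rewrite !(sign_endC (isl _ _) q_v).
- by rewrite (sign_endC (isl _ e_v) f_v) (sign_end evenS (isl _ q_v) f_v) => /negbTE->.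
- rewrite !(sign_endC (isl _ e_v)) // => nf fq; apply: contraNN nf; exact: mono fq.
- by rewrite !(sign_end evenS (isl _ _) e_v).
- rewrite (sign_end evenS (isl _ f_v) e_v) (sign_endC (isl _ f_v) q_v) => Ae Aq.
  have [eq|eq] := eqVneq e q; first by move: Aq; rewrite -eq Ae.
  apply: contraNT Aq => nsq; apply: (mono _ _ q_v e_v _ Ae).
  rewrite (sign_anti evenS eq) //.
  move: e_v q_v => /andP[h1 h2] /andP[h3 h4].
  by rewrite /overlap (lt_trans h1) // (lt_trans h3).
- by rewrite !(sign_end evenS (isl _ q_v)) //; apply: mono.
- exact: tr.
Qed.
End Chains.

Section Sweep.
Hypothesis connected : forall u w, connect edge_adj u w.

Definition level_good s A v := level_trans s v /\ level_mono s A v.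

Definition agree (s s' : E -> E -> bool) :=
  forall e f, l e = l f \/ r e = r f -> s' e f = s e f.

(** When [v] has a left edge [e0], the edges over [v] compare with [v] as they do
with [e0], so [v] has a place in the order of the preceding level. *)
Lemma sweep_step s A v : even_signs s A ->
  (forall u, x u < x v -> level_good s A u) ->
  exists s' A', [/\ even_signs s' A', agree s s' &
    forall u, x u <= x v -> level_good s' A' u].
Proof.
move=> evenS good.
have tr e f q : over e (x v) -> over f (x v) -> over q (x v) ->
    s e f -> s f q -> s e q.
  move=> ve vf vq; have h0 : x (l e) < x v by case/andP: ve.
  case: (Order.TotalTheory.arg_maxP (P := fun u => x u < x v) x h0) => u uv max.
  have [tru _] := good u uv.
  have lev h : over h (x v) -> x (l h) <= x u < x (r h).
    by move=> /andP[h1 h2]; rewrite (lt_le_trans uv h2) andbT; apply: max.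
  by apply: tru; apply: lev.
have spans_over e : spans e v -> over e (x v).
  by move=> /andP[h1 h2]; rewrite /over h1 ltW.
have {}tr' e f q : spans e v -> spans f v -> spans q v -> s e f -> s f q -> s e q.
  by move=> /spans_over ve /spans_over vf /spans_over vq; apply: tr.
have easy : level_mono s A v -> exists s' A', [/\ even_signs s' A', agree s s' &
    forall u, x u <= x v -> level_good s' A' u].
  move=> mono; exists s, A; split=> // u; rewrite le_eqVlt => /predU1P[/x_inj->|/good//].
  by split=> //; apply: (level_trans_of_mono evenS tr').
case: (pickP (fun e => r e == v)) => [e0 /eqP re0|nl].
  apply: easy => e f ve vf ef.
  have e0v : is_end v e0 by rewrite -re0 is_endr.
  rewrite -(sign_end evenS e0v ve) -(sign_end evenS e0v vf).
  apply: tr ef; try exact: spans_over.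
  by rewrite /over -re0 lexx lr.
have no_left e : r e != v by rewrite nl.
case: (pickP (fun f => spans f v)) => [f vf|nsp]; last first.
  by apply: easy => e f ve; have := nsp e; rewrite ve.
have [rr [b [f0 [a0 [v_rr isol [cb rb] vf0 [fa ra]]]]]] := horizon connected no_left vf.
(* the path from [v] to [rr] leaves [v] to the right *)
have [g lg] : exists g, l g = v.
  case/connectP: cb => [[|w p] /= pth lb]; first by exists b.
  case/andP: pth => /and3P[_ _ /existsP[e /andP[/orP[] /eqP ve _]]] _; first by exists e.
  by move: (no_left e); rewrite -ve eqxx.
have [s' [A' [even' ag sold Aold mono]]] :=
  source_insert evenS v_rr tr' isol cb rb vf0 fa ra lg no_left.
have tr2 e f1 q : spans e v -> spans f1 v -> spans q v -> s' e f1 -> s' f1 q -> s' e q.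
  have sp h : spans h v -> x (l h) < x v by case/andP.
  by move=> ve v1 vq; rewrite !sold ?sp //; apply: tr'.
exists s', A'; split=> // u; rewrite le_eqVlt => /predU1P[/x_inj->|uv].
  by split; [apply: level_trans_of_mono tr2 mono|].
have [tru monou] := good u uv; split.
  move=> e f1 q ve v1 vq; have sp h : x (l h) <= x u < x (r h) -> x (l h) < x v.
    by case/andP => h1 _; apply: le_lt_trans uv.
  by rewrite !sold ?sp //; apply: tru.
move=> e f1 ve v1; have sp h : spans h u -> x (l h) < x v.
  by case/andP => h1 _; apply: lt_trans uv.
by rewrite !sold ?sp // !Aold //; apply: monou.
Qed.

Theorem level_planar s A : even_signs s A -> exists s' A',
  [/\ even_signs s' A', agree s s' & forall v, level_good s' A' v].
Proof.
move=> evenS; pose rank v := #|[set u | x u < x v]|.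
have rank_lt u v : x u < x v -> (rank u < rank v)%N.
  move=> uv; apply: proper_card; apply/properP; split.
    by apply/fintype.subsetP => w; rewrite !inE => /lt_trans; apply.
  by exists u; rewrite !inE ?uv ?ltxx.
have rank_le u v : (rank u <= rank v)%N -> x u <= x v.
  by move=> h; rewrite leNgt; apply/negP => /rank_lt; rewrite ltnNge h.
suff [s' [A' [even' ag good]]] : exists s' A', [/\ even_signs s' A', agree s s' &
    forall v, (rank v < #|V|.+1)%N -> level_good s' A' v].
  by exists s', A'; split=> // v; apply: good; rewrite ltnS max_card.
elim: (#|V|.+1) => [|n [s1 [A1 [even1 ag1 good1]]]]; first by exists s, A; split.
case: (pickP (fun v => rank v == n)) => [v /eqP rv|nv]; last first.
  by exists s1, A1; split=> // v; rewrite ltnS leq_eqVlt nv /=; apply: good1.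
have [u uv|s2 [A2 [even2 ag2 good2]]] := @sweep_step s1 A1 v even1.
  by apply: good1; rewrite -rv rank_lt.
exists s2, A2; split=> //; first by move=> e f ef; rewrite ag2 // ag1.
by move=> u; rewrite ltnS -rv => /rank_le/good2.
Qed.
End Sweep.
End Levels.

(** * Graphs of continuous functions *)

Local Open Scope classical_set_scope.

Section Real.
Variable R : realType.
Implicit Types (a b c t x : R) (p q : R * R) (A B : set (R * R)).

Lemma near_leftP x (P : R -> Prop) : (\forall t \near x^'-, P t) <->
  exists2 c, c < x & forall t, c < t < x -> P t.
Proof.
split=> [|[c cx cP]].
  rewrite near_withinE => /nbhs_ballP[e /= e0 h]; exists (x - e); first by lra.
  move=> t /andP[t1 t2]; apply: h => //; rewrite /ball /= ltr_norml; apply/andP; split; lra.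
near=> t; apply: cP; apply/andP; split; near: t; [exact: nbhs_left_gt|exact: nbhs_left_lt].
Unshelve. all: by end_near. Qed.

Lemma near_rightP x (P : R -> Prop) : (\forall t \near x^'+, P t) <->
  exists2 c, x < c & forall t, x < t < c -> P t.
Proof.
split=> [|[c cx cP]].
  rewrite near_withinE => /nbhs_ballP[e /= e0 h]; exists (x + e); first by lra.
  move=> t /andP[t1 t2]; apply: h => //; rewrite /ball /= ltr_norml; apply/andP; split; lra.
near=> t; apply: cP; apply/andP; split; near: t; [exact: nbhs_right_gt|exact: nbhs_right_lt].
Unshelve. all: by end_near. Qed.

Lemma near_between a b x : a < x < b -> \forall t \near x, a < t < b.
Proof.
move=> axb; have : x \in `]a, b[%R by rewrite in_itv.
by move=> /near_in_itvoo; apply: filterS => t; rewrite in_itv.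
Qed.

(** Turns continuity on a segment into continuity on the line, so that curves can
be taken to be continuous everywhere. *)
Definition clamp a b x := Num.max a (Num.min b x).

Lemma clamp_in a b x : a <= b -> a <= clamp a b x <= b.
Proof. by move=> ab; rewrite /clamp le_max lexx ge_max ab ge_min lexx. Qed.

Lemma clamp_id a b x : a <= x <= b -> clamp a b x = x.
Proof. by move=> /andP[ax xb]; rewrite /clamp (min_idPr xb) (max_idPr ax). Qed.

Lemma clamp_continuous a b : continuous (clamp a b).
Proof.
move=> x; apply: (@continuous_max R R (fun=> a) (fun y => Num.min b y)).
  exact: cvg_cst.
apply: (@continuous_min R R (fun=> b) id); first exact: cvg_cst.
exact: cvg_id.
Qed.

Lemma continuous_within_comp (T : topologicalType) (D : set R) (g : R -> T) (k : R -> R) :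
  {within D, continuous g} -> continuous k -> (forall x, D (k x)) ->
  continuous (g \o k).
Proof.
move=> /subspace_continuousP cg ck Dk x U nU.
have := cg _ (Dk x) U nU; rewrite nbhs_simpl /= /within /= => h.
have := ck x _ h; rewrite !nbhs_simpl /=; apply: filterS => y; exact.
Qed.

(** The abscissa is injective and continuous along the arc, hence increasing, and
the parameter is a continuous function [k] of the abscissa. *)
Lemma arc_param_inverse g p q A : arc_param g p q A ->
  (forall x y z, A (x, y) -> A (x, z) -> y = z) -> p.1 < q.1 ->
  exists k : R -> R, [/\ continuous k,
    forall x, 0 <= k x <= 1,
    forall x, p.1 <= x <= q.1 -> (g (k x)).1 = x,
    forall s, 0 <= s <= 1 -> p.1 <= (g s).1 <= q.1 /\ k (g s).1 = s &
    forall s t, 0 <= s <= 1 -> 0 <= t <= 1 -> (s < t) = ((g s).1 < (g t).1)].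
Proof.
move=> [cg ig g0 g1 gA] fA pq; pose h s := (g s).1.
have inA s : s \in `[0, 1]%R -> A (g s) by move=> s01; rewrite -gA; apply: imageP.
have hinj : {in `[0, 1]%R &, injective h}.
  move=> s t s01 t01 hst; apply: ig; rewrite ?inE //.
  move: (inA s s01) (inA t t01) hst; rewrite /h.
  by case: (g s) => ? ?; case: (g t) => ? ? /= As At e; subst; rewrite (fA _ _ _ As At).
have ch : {within `[0%R, 1%R], continuous h}.
  by apply: within_continuous_comp cg => z _; exact: cvg_fst.
have h01 : h 0 <= h 1 by rewrite /h g0 g1 ltW.
have hmono := segment_continuous_inj_le h01 ch hinj.
have hsurj := segment_continuous_le_surjective ler01 h01 ch.
have hinv x : exists s, p.1 <= x <= q.1 -> (0 <= s <= 1) && (h s == x).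
  have [px|] := boolP (p.1 <= x <= q.1); last by exists 0.
  have : `[h 0, h 1]%classic x by rewrite /= in_itv /= /h g0 g1.
  by move=> /hsurj[s]; rewrite /= in_itv /= => s01 <-; exists s; rewrite s01 eqxx.
have [k0 kP] := choice hinv.
pose k := k0 \o clamp p.1 q.1.
have cl x : p.1 <= clamp p.1 q.1 x <= q.1 by apply: clamp_in; apply: ltW.
have k01 x : 0 <= k x <= 1 by case/andP: (kP _ (cl x)).
have hin s : 0 <= s <= 1 -> p.1 <= h s <= q.1.
  move=> s01; have z01 : (0 : R) \in `[0, 1]%R by rewrite in_itv /= lexx ler01.
  have o01 : (1 : R) \in `[0, 1]%R by rewrite in_itv /= lexx ler01.
  by rewrite -g0 -g1 -/(h 0) -/(h 1) !hmono // in_itv.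
have hK : {in `[0, 1]%R, cancel h k0}.
  move=> s s01; have hs : p.1 <= h s <= q.1 by apply: hin; rewrite in_itv in s01.
  by apply: hinj => //; case/andP: (kP _ hs) => [ks /eqP //]; rewrite in_itv.
exists k; split=> //.
- apply: (@continuous_within_comp _ `[h 0, h 1] k0 (clamp p.1 q.1)).
  + exact: segment_can_le_continuous ler01 ch hK.
  + exact: clamp_continuous.
  + by move=> x; rewrite /= in_itv /= /h g0 g1; apply: cl.
- by move=> x px; rewrite /k /= clamp_id //; case/andP: (kP _ px) => _ /eqP.
- move=> s s01; split; first exact: hin.
  by rewrite /k /= clamp_id ?hin // hK // in_itv.
- move=> s t s01 t01; rewrite !ltNge -/(h s) -/(h t) hmono // in_itv //.
Qed.

Lemma arc_param_rev g p q A : arc_param g p q A ->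
  arc_param (fun t => g (1 - t)) q p A.
Proof.
have inC (t : R) : (1 - t \in `[0, 1]%R) = (t \in `[0, 1]%R).
  by rewrite !in_itv /=; apply/idP/idP => /andP[h1 h2]; apply/andP; split; lra.
move=> [cg ig g0 g1 gA]; split.
- apply/subspace_continuousP => t t01; move/subspace_continuousP: cg => cg.
  have t01' : `[0%R, 1%R]%classic (1 - t) by rewrite /= inC.
  move=> U nU; have := cg _ t01' U nU; rewrite !nbhs_simpl /= /within /= => h.
  have c : (fun s : R => 1 - s) @ t --> 1 - t by apply: cvgB; [exact: cvg_cst|exact: cvg_id].
  have := c _ h; rewrite !nbhs_simpl /=; apply: filterS => s hs s01.
  by apply: hs; rewrite inC.
- move=> s t; rewrite !inE => s01 t01 /ig h.
  suff : 1 - s = 1 - t by lra.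
  by apply: h; rewrite inE /= inC.
- by rewrite subr0.
- by rewrite subrr.
- rewrite -gA; apply/seteqP; split=> z [t t01 <-]; exists (1 - t) => //=; rewrite ?inC //.
  by congr g; lra.
Qed.

Definition graph_on a b (y : R -> R) : set (R * R) :=
  [set z | a <= z.1 <= b /\ z.2 = y z.1].

Lemma graph_on_fun a b y x (u w : R) : graph_on a b y (x, u) -> graph_on a b y (x, w) -> u = w.
Proof. by move=> [_ /= ->] [_ /= ->]. Qed.

Lemma jordan_arc_graph p q A : jordan_arc p q A ->
  (forall x y z, A (x, y) -> A (x, z) -> y = z) -> p.1 < q.1 ->
  exists y : R -> R, continuous y /\ A = graph_on p.1 q.1 y.
Proof.
move=> [g gP] fA pq; have [k [ck k01 gk kg _]] := arc_param_inverse gP fA pq.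
case: gP => cg _ _ _ gA.
have cgk : continuous (g \o k).
  apply: (@continuous_within_comp _ `[0%R, 1%R] g k cg ck) => x.
  by rewrite /= in_itv /= k01.
exists (fun x => (g (k x)).2); split.
  by move=> x; apply: (cvg_comp _ _ (cgk x)); exact: cvg_snd.
apply/seteqP; split=> [z|[x u] [/= pxq ->]].
  rewrite -gA => -[s]; rewrite /= in_itv /= => s01 <-.
  by have [h1 h2] := kg s s01; split=> //; rewrite h2.
rewrite -gA; exists (k x); first by rewrite /= in_itv /= k01.
by rewrite -{2}(gk x pxq); case: (g (k x)).
Qed.

(** Events before and after the time [t] happen to the left and to the right of
[g t]. *)
Lemma param_side_inc g p q a b y t : arc_param g p q (graph_on a b y) ->
  p.1 < q.1 -> 0 < t < 1 -> forall P : R * R -> Prop,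
  ((\forall s \near t^'-, P (g s)) -> \forall x \near (g t).1^'-, P (x, y x)) /\
  ((\forall s \near t^'+, P (g s)) -> \forall x \near (g t).1^'+, P (x, y x)).
Proof.
move=> gP pq t01 P.
have [k [_ k01 gk kg mono]] := arc_param_inverse gP (@graph_on_fun a b y) pq.
have gxy x : p.1 <= x <= q.1 -> g (k x) = (x, y x).
  move=> pxq; have : graph_on a b y (g (k x)).
    by case: gP => _ _ _ _ <-; exists (k x) => //=; rewrite in_itv /= k01.
  by case=> _; rewrite gk // => <-; rewrite -{2}(gk x pxq); case: (g (k x)).
have tt : 0 <= t <= 1 by case/andP: t01 => *; apply/andP; split; apply: ltW.
have [tin _] := kg t tt; split.
  move=> /near_leftP[c ct cP]; apply/near_leftP.
  pose c0 := Num.max c 0.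
  have c0t : c0 < t by rewrite /c0 gt_max ct; case/andP: t01.
  have c01 : 0 <= c0 <= 1.
    by rewrite le_max lexx orbT /=; apply: le_trans (ltW c0t) _; case/andP: tt.
  have [c0in _] := kg c0 c01.
  exists (g c0).1; first by rewrite -mono.
  move=> x /andP[cx xt]; have pxq : p.1 <= x <= q.1.
    by case/andP: c0in tin => h1 _ /andP[_ h2]; apply/andP; split; lra.
  rewrite -gxy //; apply: cP; rewrite -(gk x pxq) -mono // in xt.
  rewrite xt andbT; rewrite -(gk x pxq) -mono // in cx.
  by apply: le_lt_trans cx; rewrite le_max lexx.
move=> /near_rightP[c ct cP]; apply/near_rightP.
pose c0 := Num.min c 1.
have c0t : t < c0 by rewrite /c0 lt_min ct; case/andP: t01.
have c01 : 0 <= c0 <= 1.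
  by rewrite ge_min lexx orbT andbT; apply: le_trans (ltW c0t); case/andP: tt.
have [c0in _] := kg c0 c01.
exists (g c0).1; first by rewrite -mono.
move=> x /andP[tx xc]; have pxq : p.1 <= x <= q.1.
  by case/andP: c0in tin => _ h1 /andP[h2 _]; apply/andP; split; lra.
rewrite -gxy //; apply: cP; rewrite -(gk x pxq) -mono // in tx.
rewrite tx /=; rewrite -(gk x pxq) -mono // in xc.
by apply: lt_le_trans xc _; rewrite ge_min lexx.
Qed.

Lemma pair_continuous (T : topologicalType) (f h : T -> R) :
  continuous f -> continuous h -> continuous (fun w => (f w, h w)).
Proof.
move=> cf ch w; apply: (cvg_pair (G := nbhs (f w)) (H := nbhs (h w))).
  exact: cf.
exact: ch.
Qed.

(** The preimages of [S1] and [S2] are open and cover the connected segment. *)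
Lemma path_side (u : R -> R * R) (S1 S2 : set (R * R)) :
  continuous u -> open S1 -> open S2 -> S1 `&` S2 = set0 ->
  (forall t, 0 <= t <= 1 -> (S1 `|` S2) (u t)) -> S1 (u 0) -> S1 (u 1).
Proof.
move=> cu o1 o2 dis cov u0.
have S12 z : S1 z -> S2 z -> False by move=> h1 h2; have : (S1 `&` S2) z by []; rewrite dis.
pose B := `[0%R, 1%R]%classic `&` u @^-1` S1.
have -> : S1 (u 1) = (u @^-1` S1) 1 by [].
suff BE : B = `[0%R, 1%R]%classic.
  have : `[0%R, 1%R]%classic (1 : R) by rewrite /= in_itv /= lexx ler01.
  by rewrite -BE => -[].
have z01 : `[0%R, 1%R]%classic (0 : R) by rewrite /= in_itv /= lexx ler01.
apply: (@segment_connected R 0 1).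
- by exists 0.
- exists (u @^-1` S1) => //; by apply: open_comp => // ? _; exact: cu.
- exists (~` (u @^-1` S2)).
    by apply: open_closedC; apply: open_comp => // ? _; exact: cu.
  apply/seteqP; split=> t [t01 h]; split=> //=; first by move=> /S12; apply.
  by case: (cov t) => //; move: t01; rewrite /= in_itv.
Qed.

Lemma conv_gt a (u v : R) t : a < u -> a < v -> 0 <= t <= 1 -> a < u + t * (v - u).
Proof. by move=> au av /andP[t0 t1]; case: (leP u v) => uv; nra. Qed.

Lemma conv_lt b (u v : R) t : u < b -> v < b -> 0 <= t <= 1 -> u + t * (v - u) < b.
Proof. by move=> au av /andP[t0 t1]; case: (leP u v) => uv; nra. Qed.

(** In a flat box around a point of a graph, the part on one side of the graph is
connected: go vertically away from the graph up to a height that the graph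
does not attain in the box, then horizontally.  The parameter [sg] is 1 above
the graph and -1 below it. *)
Lemma box_side (S1 S2 : set (R * R)) (y : R -> R) p (d e sg : R) :
  open S1 -> open S2 -> S1 `&` S2 = set0 -> 0 < d -> 0 < e ->
  (forall x, `|x - p.1| < d -> `|y x - p.2| < e) -> sg = 1 \/ sg = -1 ->
  let W := [set z | [/\ `|z.1 - p.1| < d, `|z.2 - p.2| < 2 * e & 0 < sg * (z.2 - y z.1)]] in
  W `<=` S1 `|` S2 -> W `<=` S1 \/ W `<=` S2.
Proof.
move=> o1 o2 dis d0 e0 ybd sgE W cov.
pose T := p.2 + sg * e.
have Tbd : `|T - p.2| < 2 * e.
  by rewrite /T; case: sgE => ->; rewrite ltr_norml; apply/andP; split; lra.
have TW x : `|x - p.1| < d -> W (x, T).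
  move=> xd; split=> //=; have := ybd x xd; rewrite ltr_norml => /andP[h1 h2].
  by rewrite /T; case: sgE => ->; lra.
have cvx (f h : R) : continuous (fun t : R => f + t * (h - f)).
  move=> t; apply: cvgD; first exact: cvg_cst.
  by apply: cvgM; [exact: cvg_id|exact: cvg_cst].
have to_base (S S' : set (R * R)) z : open S -> open S' -> S `&` S' = set0 ->
    W `<=` S `|` S' -> W z -> S z -> S (p.1, T).
  move=> oS oS' dS cS Wz Sz; have [z1 z2 z3] := Wz.
  have S1z : S (z.1, T).
    have := @path_side (fun t => (z.1, z.2 + t * (T - z.2))) S S' _ oS oS' dS.
    rewrite mul0r addr0 mul1r [z.2 + _]addrC subrK; apply.
    - by apply: pair_continuous; [move=> t; exact: cvg_cst|exact: cvx].
    - move=> t /andP[t0 t1]; apply: cS; have [_ _ T3] := TW z.1 z1; split=> //=.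
        move: Tbd z2; rewrite !ltr_norml => /andP[h1 h2] /andP[h3 h4].
        rewrite (_ : _ - p.2 = (z.2 - p.2) + t * ((T - p.2) - (z.2 - p.2))); last by ring.
        by apply/andP; split; [apply: conv_gt|apply: conv_lt]; rewrite ?t0.
      rewrite (_ : sg * _ = sg * (z.2 - y z.1) + t * (sg * (T - y z.1) - sg * (z.2 - y z.1)));
        last by ring.
      by apply: conv_gt; rewrite ?t0.
    - by case: z Sz {Wz z1 z2 z3}.
  have := @path_side (fun t => (z.1 + t * (p.1 - z.1), T)) S S' _ oS oS' dS.
  rewrite mul0r addr0 mul1r [z.1 + _]addrC subrK; apply => //.
    by apply: pair_continuous; [exact: cvx|move=> t; exact: cvg_cst].
  move=> t /andP[t0 t1]; apply: cS; apply: TW.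
  rewrite (_ : _ - p.1 = (1 - t) * (z.1 - p.1)); last by ring.
  rewrite normrM ger0_norm ?subr_ge0 //; apply: le_lt_trans z1.
  by rewrite ler_piMl // lerBlDl lerDr.
have Wp : W (p.1, T) by apply: TW; rewrite subrr normr0.
have S12 z : S1 z -> S2 z -> False by move=> h1 h2; have : (S1 `&` S2) z by []; rewrite dis.
case: (cov _ Wp) => Sp; [left|right] => z Wz; case: (cov _ Wz) => // Sz; exfalso.
  by apply: (S12 _ Sp); apply: (to_base S2 S1 z) => //; rewrite 1?setIC 1?setUC.
by apply: (S12 (p.1, T)) => //; apply: (to_base S1 S2 z).
Qed.

(** * Proper crossings change signs *)

Lemma near_at_left x (P : R -> Prop) : (\forall t \near x, P t) -> \forall t \near x^'-, P t.
Proof. by move=> h; apply: cvg_within. Qed.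

Lemma near_at_right x (P : R -> Prop) : (\forall t \near x, P t) -> \forall t \near x^'+, P t.
Proof. by move=> h; apply: cvg_within. Qed.

(** The second alternative is that of an arc run through from right to left. *)
Lemma param_side g p q a b y t (P Q : R * R -> Prop) :
  arc_param g p q (graph_on a b y) -> 0 < t < 1 ->
  (\forall s \near t^'-, P (g s)) -> (\forall s \near t^'+, Q (g s)) ->
  ((\forall x \near (g t).1^'-, P (x, y x)) /\ (\forall x \near (g t).1^'+, Q (x, y x))) \/
  ((\forall x \near (g t).1^'-, Q (x, y x)) /\ (\forall x \near (g t).1^'+, P (x, y x))).
Proof.
move=> gP t01 nP nQ; case: (ltgtP p.1 q.1) => pq.
- left; have [h1 _] := param_side_inc gP pq t01 P.
  by have [_ h2] := param_side_inc gP pq t01 Q; split; auto.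
- right; have t01' : 0 < 1 - t < 1 by case/andP: t01 => *; apply/andP; split; lra.
  have gP' := arc_param_rev gP.
  have [h1 _] := param_side_inc gP' pq t01' Q.
  have [_ h2] := param_side_inc gP' pq t01' P.
  rewrite (_ : 1 - (1 - t) = t) in h1 h2; last by ring.
  split.
    apply: h1; case/near_rightP: nQ => c tc cQ; apply/near_leftP.
    exists (1 - c); first by lra.
    by move=> s /andP[s1 s2]; apply: cQ; apply/andP; split; lra.
  apply: h2; case/near_leftP: nP => c tc cP; apply/near_rightP.
  exists (1 - c); first by lra.
  by move=> s /andP[s1 s2]; apply: cP; apply/andP; split; lra.
- exfalso; have [_ ig g0 g1 gA] := gP.
  have inG s : 0 <= s <= 1 -> graph_on a b y (g s).
    by move=> s01; rewrite -gA; exists s => //=; rewrite in_itv.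
  have [] : (0 <= (0 : R) <= 1) /\ (0 <= (1 : R) <= 1) by rewrite !lexx !ler01.
  move=> z01 o01; suff : (0 : R) = 1 by lra.
  apply: ig; rewrite ?inE /= ?in_itv //=.
  have := inG 0 z01; have := inG 1 o01; rewrite g0 g1 => -[_ h1] [_ h0].
  by case: p q pq h0 h1 {g0 g1 gP} => [p1 p2] [q1 q2] /= -> -> ->.
Qed.

(** Near [p] the complement of the graph [A] is made of the points above and the
points below.  Each of these parts lies in one of the local sides; not in the
same one, as both local sides accumulate at [p].  So [B] passes from below to
above or conversely. *)
Lemma cross_sign (yA yB : R -> R) a1 b1 a2 b2 p :
  continuous yA -> continuous yB -> a1 < p.1 < b1 -> p.2 = yA p.1 ->
  properly_crosses (graph_on a2 b2 yB) (graph_on a1 b1 yA) p ->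
  ((\forall x \near p.1^'-, yB x < yA x) /\ (\forall x \near p.1^'+, yA x < yB x)) \/
  ((\forall x \near p.1^'-, yA x < yB x) /\ (\forall x \near p.1^'+, yB x < yA x)).
Proof.
move=> cA cB pab pA [U [S1 [S2 [a [b [g [t [loc gP [t01 gt] n1 n2]]]]]]]].
case: loc => [[ oU Up] [cover dis] [ op1 _] [ op2 _] [cl1 cl2]].
have pB : p.2 = yB p.1.
  have : graph_on a2 b2 yB p; last by case.
  case: gP => _ _ _ _ <-; exists t => //=; rewrite in_itv /=.
  by case/andP: t01 => h1 h2; rewrite !ltW.
have /nbhs_ballP[e0 /= e0_gt0 eU] : nbhs p U by apply: open_nbhs_nbhs.
(* the box has half-height [2 * e], and the graph stays in its middle half *)
pose e := e0 / 2; have e_gt0 : 0 < e by rewrite /e; lra.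
have /nbhs_ballP[d0 /= d0_gt0 dP] : \forall x \near p.1, a1 < x < b1 /\ `|yA x - p.2| < e.
  have near_e : \forall x \near p.1, `|yA x - p.2| < e.
    by rewrite pA; exact: (@cvgr_distC_lt R R^o R (nbhs p.1) _ yA (yA p.1) (cA p.1) e e_gt0).
  exact: (filterI (near_between pab) near_e).
pose d := Num.min d0 e0.
have d_gt0 : 0 < d by rewrite lt_min d0_gt0.
have dA x : `|x - p.1| < d -> a1 < x < b1 /\ `|yA x - p.2| < e.
  by rewrite lt_min => /andP[xd _]; apply: dP; rewrite /ball /= distrC.
pose Box := [set z : R * R | `|z.1 - p.1| < d /\ `|z.2 - p.2| < 2 * e].
pose W sg := [set z : R * R | [/\ `|z.1 - p.1| < d, `|z.2 - p.2| < 2 * e & 0 < sg * (z.2 - yA z.1)]].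
have BoxU z : Box z -> U z.
  move=> [z1 z2]; apply: eU; split; rewrite /ball /= distrC; last by rewrite /e in z2; lra.
  by apply: lt_le_trans z1 _; rewrite ge_min lexx orbT.
have W12 sg : W sg `<=` S1 `|` S2.
  move=> z [z1 z2 z3]; rewrite -cover; split; first exact: BoxU.
  by move=> [_ zA]; move: z3; rewrite zA subrr mulr0 ltxx.
have S_W z : (S1 `|` S2) z -> Box z -> W 1 z \/ W (-1) z.
  rewrite -cover => -[_ nA] [z1 z2]; have [/andP[h1 h2] _] := dA _ z1.
  have : z.2 != yA z.1 by apply/eqP => zA; apply: nA; split=> //; rewrite !ltW.
  by rewrite neq_lt => /orP[h|h]; [right|left]; split=> //; lra.
have Box_nbhs : nbhs p Box.
  apply/nbhs_ballP; exists (Num.min d (2 * e)) => /=.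
    by rewrite lt_min d_gt0 mulr_gt0.
  move=> z [z1 z2]; split; [move: z1|move: z2]; rewrite /ball /= distrC lt_min => /andP[] //.
have [z1 [Sz1 Bz1]] := cl1 _ Box_nbhs.
have [z2 [Sz2 Bz2]] := cl2 _ Box_nbhs.
have S12 z : S1 z -> S2 z -> False by move=> h1 h2; have : (S1 `&` S2) z by []; rewrite dis.
have Wz1 := S_W z1 (or_introl Sz1) Bz1; have Wz2 := S_W z2 (or_intror Sz2) Bz2.
have bx sg : sg = 1 \/ sg = -1 -> W sg `<=` S1 \/ W sg `<=` S2.
  move=> sgE; have dA' x : `|x - p.1| < d -> `|yA x - p.2| < e by move=> /dA[].
  exact: (box_side op1 op2 dis d_gt0 e_gt0 dA' sgE (W12 sg)).
have [sg [sgE SW1 SW2]] : exists sg : R, [/\ sg = 1 \/ sg = -1,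
    forall z, S1 z -> Box z -> W sg z & forall z, S2 z -> Box z -> W (- sg) z].
  case: (bx 1 (or_introl erefl)) => w1; case: (bx (-1) (or_intror erefl)) => w2.
  - by exfalso; case: Wz2 => [/w1|/w2] /S12; apply.
  - exists 1; split; first by left.
      by move=> z Sz Bz; case: (S_W z (or_introl Sz) Bz) => // /w2 /(S12 _ Sz).
    by move=> z Sz Bz; case: (S_W z (or_intror Sz) Bz) => // /w1 /S12 /(_ Sz).
  - exists (-1); split; first by right.
      by move=> z Sz Bz; case: (S_W z (or_introl Sz) Bz) => // /w1 /(S12 _ Sz).
    by rewrite opprK => z Sz Bz; case: (S_W z (or_intror Sz) Bz) => // /w2 /S12 /(_ Sz).
  - by exfalso; case: Wz1 => [/w1|/w2] /(S12 _ Sz1).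
have BB : \forall x \near p.1, Box (x, yB x).
  have : (fun x => (x, yB x)) @ p.1 --> (p.1, yB p.1).
    have cid : continuous (id : R -> R) by move=> x; exact: cvg_id.
    exact: (@pair_continuous R id yB cid cB p.1).
  by rewrite -pB -surjective_pairing => /(_ _ Box_nbhs).
have sgn s0 x : W s0 (x, yB x) -> 0 < s0 * (yB x - yA x) by case.
have fin (F : set_system R) (FF : Filter F) (S : set (R * R)) s0 :
    (forall z, S z -> Box z -> W s0 z) -> F [set x | Box (x, yB x)] ->
    F [set x | S (x, yB x)] -> F [set x | 0 < s0 * (yB x - yA x)].
  by move=> SW; apply: filterS2 => x Bx Sx; apply: sgn; apply: SW.
have [Bl Br] := (near_at_left BB, near_at_right BB).
have conv_pos (F : set_system R) (FF : Filter F) s0 : F [set x | 0 < s0 * (yB x - yA x)] ->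
    (s0 = 1 -> F [set x | yA x < yB x]) /\ (s0 = -1 -> F [set x | yB x < yA x]).
  by move=> h; split=> sE; move: h; rewrite sE; apply: filterS => x /=; lra.
have := param_side gP t01 n1 n2; rewrite gt => -[[l1 r2]|[l2 r1]].
  have [h1 h2] := conv_pos _ _ _ (fin _ _ _ _ SW1 Bl l1).
  have [h3 h4] := conv_pos _ _ _ (fin _ _ _ _ SW2 Br r2).
  case: sgE => sE; [right|left]; split; try exact: h1; try exact: h2; try (apply: h3; lra); apply: h4; lra.
have [h1 h2] := conv_pos _ _ _ (fin _ _ _ _ SW2 Bl l2).
have [h3 h4] := conv_pos _ _ _ (fin _ _ _ _ SW1 Br r1).
case: sgE => sE; [left|right]; split; try exact: h3; try exact: h4; try (apply: h1; lra); apply: h2; lra.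
Qed.

(** * Counting sign changes *)

Section Parity.
Variables (d : R -> R) (a b : R) (F : seq R).
Hypothesis cd : continuous d.
Hypothesis ab : a < b.
Hypothesis uF : uniq F.
Hypothesis FP : forall z, z \in F <-> a < z < b /\ d z = 0.
Hypothesis change : forall z, z \in F ->
  ((\forall t \near z^'-, d t < 0) /\ (\forall t \near z^'+, 0 < d t)) \/
  ((\forall t \near z^'-, 0 < d t) /\ (\forall t \near z^'+, d t < 0)).

Let N x y : nat := (\sum_(w <- F) (x < w < y)%R)%N.

Lemma no_zero_sign x y : a < x -> x < y -> y < b -> d x != 0 -> d y != 0 ->
  N x y = 0%N -> (d x < 0) = (d y < 0).
Proof.
move=> ax xy yb dx dy n0.
have [] : (forall z, x < z < y -> d z = 0 -> False) /\ True; last first.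
  move=> nz _; have cont : {within `[x, y], continuous d} by exact: continuous_subspaceT.
  have ivt := @IVT R d x y 0 (ltW xy) cont.
  case: (ltgtP (d x) 0) dx => // hx _; case: (ltgtP (d y) 0) dy => // hy _.
    exfalso; have [|z] := ivt; first by rewrite ge_min le_max (ltW hx) (ltW hy) ?orbT.
    rewrite in_itv /= => /andP[h1 h2] dz; apply: (nz z) => //.
    rewrite !lt_neqAle h1 h2 !andbT; apply/andP; split; apply/eqP => e.
      by rewrite e dz ltxx in hx.
    by rewrite -e dz ltxx in hy.
  exfalso; have [|z] := ivt; first by rewrite ge_min le_max (ltW hx) (ltW hy) ?orbT.
  rewrite in_itv /= => /andP[h1 h2] dz; apply: (nz z) => //.
  rewrite !lt_neqAle h1 h2 !andbT; apply/andP; split; apply/eqP => e.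
    by rewrite e dz ltxx in hx.
  by rewrite -e dz ltxx in hy.
split=> // z /andP[xz zy] dz; have zF : z \in F.
  by apply/FP; rewrite (lt_trans ax xz) (lt_trans zy yb).
by move/eqP: n0; rewrite /N (perm_big _ (perm_to_rem zF)) big_cons xz zy.
Qed.

(** Remove one zero at a time: close to a zero [z] there are points on both sides
with opposite signs and with no zero but [z] between them. *)
Lemma sign_count n x y : (N x y <= n)%N -> a < x -> x < y -> y < b ->
  d x != 0 -> d y != 0 -> (d x < 0) (+) (d y < 0) = odd (N x y).
Proof.
elim: n x y => [|n IH] x y.
  by rewrite leqn0 => /eqP n0 ax xy yb dx dy; rewrite (no_zero_sign ax xy yb) // n0 addbb.
move=> Nn ax xy yb dx dy.
case: (boolP (has (fun w => x < w < y) F)) => [/hasP[z zF /andP[xz zy]]|/hasPn no]; last first.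
  have n0 : N x y = 0%N by apply: big1_seq => w /= /no /negbTE->.
  by rewrite (no_zero_sign ax xy yb) // n0 addbb.
have [sg [/near_leftP[c1 c1z h1] /near_rightP[c2 zc2 h2]]] : exists sg,
    (\forall t \near z^'-, (d t != 0) && ((d t < 0) == sg)) /\
    (\forall t \near z^'+, (d t != 0) && ((d t < 0) == ~~ sg)).
  case: (change zF) => [[k1 k2]|[k1 k2]]; [exists true|exists false]; split.
  - by apply: filterS k1 => t; case: (ltgtP (d t) 0).
  - by apply: filterS k2 => t; case: (ltgtP (d t) 0).
  - by apply: filterS k1 => t; case: (ltgtP (d t) 0).
  - by apply: filterS k2 => t; case: (ltgtP (d t) 0).
(* points so close to [z] that the signs there are those given by [change] *)
pose z1 := (Num.max c1 x + z) / 2; pose z2 := (Num.min c2 y + z) / 2.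
have m1 : Num.max c1 x < z by rewrite gt_max c1z.
have m2 : z < Num.min c2 y by rewrite lt_min zc2.
have l1 : c1 <= Num.max c1 x by rewrite le_max lexx.
have l2 : x <= Num.max c1 x by rewrite le_max lexx orbT.
have l3 : Num.min c2 y <= c2 by rewrite ge_min lexx.
have l4 : Num.min c2 y <= y by rewrite ge_min lexx orbT.
have /andP[dz1 /eqP s1] : (d z1 != 0) && ((d z1 < 0) == sg).
  by apply: h1; rewrite /z1; apply/andP; split; lra.
have /andP[dz2 /eqP s2] : (d z2 != 0) && ((d z2 < 0) == ~~ sg).
  by apply: h2; rewrite /z2; apply/andP; split; lra.
have xz1 : x < z1 by rewrite /z1; lra.
have z2y : z2 < y by rewrite /z2; lra.
have z1z : z1 < z by rewrite /z1; lra.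
have zz2 : z < z2 by rewrite /z2; lra.
have c1z1 : c1 < z1 by rewrite /z1; lra.
have z2c2 : z2 < c2 by rewrite /z2; lra.
have NE : N x y = (N x z1 + 1 + N z2 y)%N.
  have -> : 1%N = (\sum_(w <- F) (w == z))%N.
    rewrite (perm_big _ (perm_to_rem zF)) big_cons eqxx big1_seq // => w /=.
    by rewrite mem_rem_uniq // inE => /andP[/negbTE->].
  rewrite /N -!big_split /=; apply: eq_big_seq => w wF.
  have [_ dw] : a < w < b /\ d w = 0 by apply/FP.
  have n1 : ~~ (c1 < w < z) by apply/negP => /h1; rewrite dw eqxx.
  have n2 : ~~ (z < w < c2) by apply/negP => /h2; rewrite dw eqxx.
  move: n1 n2; rewrite !negb_and -!leNgt.
  case: (ltgtP w z) => wz; rewrite /= ?orbT ?orbF // => n1 n2.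
  - have -> : z2 < w = false by apply/negbTE; rewrite -leNgt; lra.
    have -> : w < y by lra.
    have -> : w < z1 by lra.
    by rewrite !andbT /= !addn0.
  - have -> : w < z1 = false by apply/negbTE; rewrite -leNgt; lra.
    have -> : x < w by lra.
    have -> : z2 < w by lra.
    by rewrite andbF.
  - subst w; have -> : z2 < z = false by apply/negbTE; rewrite -leNgt; lra.
    have -> : z < z1 = false by apply/negbTE; rewrite -leNgt; lra.
    by rewrite xz zy andbF.
have IH1 : (d x < 0) (+) (d z1 < 0) = odd (N x z1).
  by apply: IH => //; [move: Nn; rewrite NE addn1 addSn ltnS; apply: leq_trans; exact: leq_addr|lra].
have IH2 : (d z2 < 0) (+) (d y < 0) = odd (N z2 y).
  by apply: IH => //; [move: Nn; rewrite NE addn1 addSn ltnS; apply: leq_trans; exact: leq_addl|lra].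
rewrite NE !oddD -IH1 -IH2 s1 s2 /=.
by case: (d x < 0); case: (d y < 0); case: sg {h1 h2 s1 s2}.
Qed.

(** No zero accumulates at [a] or [b], so that the count applies to points close to
both of them. *)
Lemma even_sign : ~~ odd (size F) ->
  ((\forall t \near a^'+, d t < 0) /\ (\forall t \near b^'-, d t < 0)) \/
  ((\forall t \near a^'+, 0 < d t) /\ (\forall t \near b^'-, 0 < d t)).
Proof.
pose m := (a + b) / 2.
have mid (u v : R) : u < v -> u < (u + v) / 2 < v.
  by move=> uv; apply/andP; split; lra.
have /andP[am mb] : a < m < b by apply: mid.
move=> evF.
have [c1 [ac1 c1m c1F]] : exists c1, [/\ a < c1, c1 <= m & forall w, w \in F -> c1 <= w].
  have : forall w, w \in F -> a < w by move=> w /FP[/andP[]].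
  elim: (F) => [_|w G IHG aG]; first by exists m; split=> // w; rewrite in_nil.
  have [|c [ac cm cG]] := IHG; first by move=> u uG; apply: aG; rewrite inE uG orbT.
  exists (Num.min c w); split; first by rewrite lt_min ac aG // inE eqxx.
    by rewrite ge_min cm.
  by move=> u; rewrite inE ge_min => /predU1P[->|/cG->]; rewrite ?lexx ?orbT.
have [c2 [c2b mc2 c2F]] : exists c2, [/\ c2 < b, m <= c2 & forall w, w \in F -> w <= c2].
  have : forall w, w \in F -> w < b by move=> w /FP[/andP[]].
  elim: (F) => [_|w G IHG aG]; first by exists m; split=> // w; rewrite in_nil.
  have [|c [ac cm cG]] := IHG; first by move=> u uG; apply: aG; rewrite inE uG orbT.
  exists (Num.max c w); split; first by rewrite gt_max ac aG // inE eqxx.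
    by rewrite le_max cm.
  by move=> u; rewrite inE le_max => /predU1P[->|/cG->]; rewrite ?lexx ?orbT.
have nz1 t : a < t < c1 -> d t != 0.
  move=> /andP[h1 h2]; apply/eqP => dt.
  have /c1F : t \in F by apply/FP; split=> //; rewrite h1 (lt_le_trans h2) // (le_trans c1m) // ltW.
  by rewrite leNgt h2.
have nz2 t : c2 < t < b -> d t != 0.
  move=> /andP[h1 h2]; apply/eqP => dt.
  have /c2F : t \in F by apply/FP; split=> //; rewrite h2 andbT (le_lt_trans _ h1) // (le_trans _ mc2) // ltW.
  by rewrite leNgt h1.
have same t u : a < t < c1 -> c2 < u < b -> (d t < 0) = (d u < 0).
  move=> ht hu; have := fun tu => @sign_count (N t u) t u (leqnn _) (proj1 (andP ht)) tu (proj2 (andP hu)) (nz1 t ht) (nz2 u hu).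
  case/andP: (ht) => t1 t2; case/andP: (hu) => u1 u2.
  have -> : N t u = size F.
    rewrite -sum1_size; apply: eq_big_seq => w wF.
    by rewrite (lt_le_trans t2 (c1F w wF)) (le_lt_trans (c2F w wF) u1).
  have tu : t < u by lra.
  by move=> /(_ tu); rewrite (negbTE evF); case: (d t < 0); case: (d u < 0).
pose t0 := (a + c1) / 2; pose u0 := (c2 + b) / 2.
have t0P : a < t0 < c1 by apply: mid.
have u0P : c2 < u0 < b by apply: mid.
have sa t : a < t < c1 -> (d t < 0) = (d t0 < 0).
  by move=> ht; rewrite (same t u0) // (same t0 u0).
have sb u : c2 < u < b -> (d u < 0) = (d t0 < 0).
  by move=> hu; rewrite (same t0 u).
have pos t : d t != 0 -> (d t < 0) = false -> 0 < d t by case: (ltgtP (d t) 0).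
case h0 : (d t0 < 0); [left|right]; split.
- by apply/near_rightP; exists c1 => // t /sa; rewrite h0.
- by apply/near_leftP; exists c2 => // t /sb; rewrite h0.
- by apply/near_rightP; exists c1 => // t ht; apply: pos (nz1 t ht) _; rewrite sa.
- by apply/near_leftP; exists c2 => // t ht; apply: pos (nz2 t ht) _; rewrite sb.
Qed.
End Parity.
End Real.

(** * Signs of a monotone drawing *)

Definition edge (G : sgraph) := {e : {set G} | e \in edges G}.

Section Drawn.
Variables (R : realType) (G : sgraph).
Implicit Types (D : drawing R G) (e f : edge G) (u v : G).

Definition xpos D v : R := (pos D v).1.

(** Each curve is a function continuous on the whole line, of which the arc is the part
between the abscissae of the endpoints. *)
Record drawn_as D (l r : edge G -> G) (y : edge G -> R -> R) : Prop := {
  ends_lt : forall e, xpos D (l e) < xpos D (r e);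
  ends_set : forall e, val e = [set l e; r e]%SET;
  curve_continuous : forall e, continuous (y e);
  curve_left : forall e, y e (xpos D (l e)) = (pos D (l e)).2;
  curve_right : forall e, y e (xpos D (r e)) = (pos D (r e)).2;
  arc_curve : forall e,
    Defs.arc D (val e) = graph_on (xpos D (l e)) (xpos D (r e)) (y e) }.

Arguments curve_continuous {D l r y} _ e.

Lemma jordan_arc_ends (p q : R * R) A : jordan_arc p q A -> A p /\ A q.
Proof.
move=> [g [_ _ g0 g1 gA]]; rewrite -gA; split.
  by exists 0 => //=; rewrite in_itv /= lexx ler01.
by exists 1 => //=; rewrite in_itv /= lexx ler01.
Qed.

Lemma monotone_drawn_as D : x_monotone D -> exists l r y, drawn_as D l r y.
Proof.
move=> mono.
have ends e : exists uv : G * G, [/\ adj uv.1 uv.2, val e = [set uv.1; uv.2]%SET &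
    xpos D uv.1 < xpos D uv.2].
  case: e => e /=; rewrite inE => /existsP[u /existsP[v /andP[uv /eqP eE]]].
  case: (ltgtP (xpos D u) (xpos D v)) => h.
  - by exists (u, v).
  - by exists (v, u); rewrite /= adj_sym; split=> //; rewrite finset.setUC.
  - by move: uv; rewrite (vertex_abscissae_inj h) adj_irrefl.
have [lr lrP] := choice ends.
have ys e : exists y : R -> R, continuous y /\
    Defs.arc D (val e) = graph_on (xpos D (lr e).1) (xpos D (lr e).2) y.
  have [a eE lt] := lrP e; have := arc_joins D a; rewrite -eE => ja.
  exact: jordan_arc_graph ja (mono _ (valP e)) lt.
have [y yP] := choice ys.
exists (fun e => (lr e).1), (fun e => (lr e).2), y.
have on e : (y e (xpos D (lr e).1) = (pos D (lr e).1).2) /\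
            (y e (xpos D (lr e).2) = (pos D (lr e).2).2).
  have [a eE lt] := lrP e; have := arc_joins D a; rewrite -eE.
  by have [_ ->] := yP e => ja; have [[_ ->] [_ ->]] := jordan_arc_ends ja.
by split=> e; have [a eE lt] := lrP e; have [c aE] := yP e; have [h1 h2] := on e.
Qed.

Section Local.
Variables (D : drawing R G) (l r : edge G -> G) (y : edge G -> R -> R).
Hypothesis DA : drawn_as D l r y.
Let x := xpos D.

Lemma mem_edge e v : (v \in val e) = is_end l r v e.
Proof. by rewrite (ends_set DA) !inE. Qed.

Lemma curve_end e v : is_end l r v e -> y e (x v) = (pos D v).2.
Proof. by move=> /orP[]/eqP->; [exact: curve_left DA e|exact: curve_right DA e]. Qed.

Lemma on_arc_end e v p : is_end l r v e -> Defs.arc D (val e) p -> p.1 = x v -> p = pos D v.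
Proof.
move=> ve; rewrite (arc_curve DA) => -[_ p2] p1.
by rewrite (surjective_pairing p) (surjective_pairing (pos D v)) p2 p1 curve_end.
Qed.

(** Transfers statements about points of the plane close to [v] to statements about
abscissae. *)
Lemma near_curve e v (P : R * R -> Prop) : is_end l r v e ->
  (\forall p \near pos D v, P p) -> \forall t \near x v, P (t, y e t).
Proof.
move=> ve nP; have cid : continuous (id : R -> R) by move=> z; exact: cvg_id.
have := @pair_continuous R R id (y e) cid (curve_continuous DA e) (x v).
rewrite /continuous_at curve_end // -surjective_pairing.
by move=> /(_ _ nP); apply.
Qed.

Lemma on_curve e t : x (l e) < t < x (r e) -> Defs.arc D (val e) (t, y e t).
Proof. by move=> /andP[h1 h2]; rewrite (arc_curve DA); split=> //=; rewrite !ltW. Qed.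

Lemma near_left_span e v : v = r e -> \forall t \near (x v)^'-, x (l e) < t < x (r e).
Proof.
move=> ->; apply/near_leftP; exists (x (l e)); first exact: ends_lt DA e.
by [].
Qed.

Lemma near_right_span e v : v = l e -> \forall t \near (x v)^'+, x (l e) < t < x (r e).
Proof.
move=> ->; apply/near_rightP; exists (x (r e)); first exact: ends_lt DA e.
by [].
Qed.

Lemma leaves_rightP v e : v \in val e -> (leaves_right D v (val e) <-> v = l e).
Proof.
rewrite mem_edge => ve; split=> [|vl].
  move=> lr; case/orP: (ve) => /eqP // vr; exfalso.
  have h := near_at_left (near_curve ve lr); have h' := near_left_span vr.
  have [t [tP t2]] := @filter_ex _ (x v)^'- _ _ (filterI h h'); have /andP[_ t3] := t2.
  have tv : (t, y e t) <> pos D v.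
    by move=> tE; move: t3; rewrite -[t]/((t, y e t).1) tE vr ltxx.
  have h3 : x v < t := tP (on_curve t2) tv.
  by move: h3; rewrite vr => /(lt_trans t3); rewrite ltxx.
apply: filterE => p pe pv; have := pe; rewrite (arc_curve DA) => -[/andP[h _] _].
rewrite lt_neqAle vl h andbT; apply/eqP => h1; apply: pv.
by apply: (on_arc_end ve pe); rewrite vl.
Qed.

Lemma leaves_leftP v e : v \in val e -> (leaves_left D v (val e) <-> v = r e).
Proof.
rewrite mem_edge => ve; split=> [|vl].
  move=> lr; case/orP: (ve) => /eqP // vr; exfalso.
  have h := near_at_right (near_curve ve lr); have h' := near_right_span vr.
  have [t [tP t2]] := @filter_ex _ (x v)^'+ _ _ (filterI h h'); have /andP[t3 _] := t2.
  have tv : (t, y e t) <> pos D v.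
    by move=> tE; move: t3; rewrite -[t]/((t, y e t).1) tE vr ltxx.
  have h3 : t < x v := tP (on_curve t2) tv.
  by move: h3; rewrite vr => /lt_trans/(_ t3); rewrite ltxx.
apply: filterE => p pe pv; have := pe; rewrite (arc_curve DA) => -[/andP[_ h] _].
rewrite lt_neqAle vl h andbT; apply/eqP => h1; apply: pv.
by apply: (on_arc_end ve pe); rewrite vl.
Qed.

Lemma below_right v e f : v = l e -> v = l f ->
  (lies_below D v (val e) (val f) <-> \forall t \near (x v)^'+, y e t < y f t).
Proof.
move=> ve vf.
have ende : is_end l r v e by rewrite ve is_endl.
have endf : is_end l r v f by rewrite vf is_endl.
split.
  move=> [[A B] /= [nA nB] AB].
  have hA := near_at_right (near_curve ende nA).
  have hB := near_at_right (near_curve endf nB).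
  have hs := near_right_span ve; have hs' := near_right_span vf.
  near=> t.
  have te : x (l e) < t < x (r e) by near: t.
  have tf : x (l f) < t < x (r f) by near: t.
  have h : (A `*` B) ((t, y e t), (t, y f t)) by split; near: t.
  apply: (AB _ h) => //=; [exact: on_curve|exact: on_curve| |].
    by move=> hh; case/andP: te; rewrite -[t]/((t, y e t).1) hh ve ltxx.
  by move=> hh; case/andP: tf; rewrite -[t]/((t, y f t).1) hh vf ltxx.
move=> /near_rightP[c vc h].
exists ([set p | p.1 < c], setT) => /=.
  split; last exact: filterT.
  have : \forall t \near x v, t < c.
    have : x v - 1 < x v < c by rewrite vc andbT; lra.
    by move=> /near_between; apply: filterS => t /andP[].
  exact: (@cvg_fst R R (nbhs (x v)) (nbhs (pos D v).2) _).
move=> [p q] [/= pc _] pe qf pv qv pq.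
have [/andP[h1 _] p2] : graph_on (x (l e)) (x (r e)) (y e) p by rewrite -(arc_curve DA).
have [_ q2] : graph_on (x (l f)) (x (r f)) (y f) q by rewrite -(arc_curve DA).
rewrite p2 q2 -pq; apply: h; rewrite pc andbT lt_neqAle ve h1 andbT.
by apply/eqP => h2; apply: pv; apply: (on_arc_end ende pe); rewrite ve.
Unshelve. all: by end_near. Qed.

Lemma below_left v e f : v = r e -> v = r f ->
  (lies_below D v (val e) (val f) <-> \forall t \near (x v)^'-, y e t < y f t).
Proof.
move=> ve vf.
have ende : is_end l r v e by rewrite ve is_endr.
have endf : is_end l r v f by rewrite vf is_endr.
split.
  move=> [[A B] /= [nA nB] AB].
  have hA := near_at_left (near_curve ende nA).
  have hB := near_at_left (near_curve endf nB).
  have hs := near_left_span ve; have hs' := near_left_span vf.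
  near=> t.
  have te : x (l e) < t < x (r e) by near: t.
  have tf : x (l f) < t < x (r f) by near: t.
  have h : (A `*` B) ((t, y e t), (t, y f t)) by split; near: t.
  apply: (AB _ h) => //=; [exact: on_curve|exact: on_curve| |].
    by move=> hh; case/andP: te; rewrite -[t]/((t, y e t).1) hh ve ltxx.
  by move=> hh; case/andP: tf; rewrite -[t]/((t, y f t).1) hh vf ltxx.
move=> /near_leftP[c vc h].
exists ([set p | c < p.1], setT) => /=.
  split; last exact: filterT.
  have : \forall t \near x v, c < t.
    have : c < x v < x v + 1 by rewrite vc /=; lra.
    by move=> /near_between; apply: filterS => t /andP[].
  exact: (@cvg_fst R R (nbhs (x v)) (nbhs (pos D v).2) _).
move=> [p q] [/= pc _] pe qf pv qv pq.
have [/andP[_ h1] p2] : graph_on (x (l e)) (x (r e)) (y e) p by rewrite -(arc_curve DA).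
have [_ q2] : graph_on (x (l f)) (x (r f)) (y f) q by rewrite -(arc_curve DA).
rewrite p2 q2 -pq; apply: h; rewrite pc /= lt_neqAle ve h1 andbT.
by apply/eqP => h2; apply: pv; apply: (on_arc_end ende pe); rewrite ve.
Unshelve. all: by end_near. Qed.

Let lr e : x (l e) < x (r e). Proof. exact: ends_lt DA e. Qed.

Lemma interiorP e p : arc_interior (pos D) (Defs.arc D) (val e) p <->
  x (l e) < p.1 < x (r e) /\ p.2 = y e p.1.
Proof.
split=> [[pe np]|[p1 p2]]; last first.
  split; first by rewrite (arc_curve DA); split=> //; case/andP: p1 => *; rewrite !ltW.
  move=> [v /=]; rewrite mem_edge => /orP[]/eqP-> pE; move: p1; rewrite -pE;
  by rewrite -/(xpos D _) -/x ltxx ?andbF.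
have := pe; rewrite (arc_curve DA) => -[/andP[h1 h2] p2]; split=> //.
rewrite !lt_neqAle h1 h2 !andbT; apply/andP; split; apply/eqP => h; apply: np.
  exists (l e); first by rewrite /= mem_edge is_endl.
  by apply: esym; apply: (on_arc_end _ pe) => //; rewrite is_endl.
exists (r e); first by rewrite /= mem_edge is_endr.
by apply: esym; apply: (on_arc_end _ pe) => //; rewrite is_endr.
Qed.

Let lo e f := Num.max (x (l e)) (x (l f)).
Let hi e f := Num.min (x (r e)) (x (r f)).

Hypothesis evenD : even_drawing D.

Lemma overlap_lt e f : overlap l r x e f -> lo e f < hi e f.
Proof. by move=> /andP[h1 h2]; rewrite gt_max !lt_min !lr h1 h2. Qed.

(** The difference of the two functions has one zero for each crossing and changes
sign there, so an even number of times. *)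
Lemma dichotomy e f : e != f -> overlap l r x e f ->
  ((\forall t \near (lo e f)^'+, y e t < y f t) /\
   (\forall t \near (hi e f)^'-, y e t < y f t)) \/
  ((\forall t \near (lo e f)^'+, y f t < y e t) /\
   (\forall t \near (hi e f)^'-, y f t < y e t)).
Proof.
move=> ef /overlap_lt ov.
have nef : val e != val f by rewrite (inj_eq val_inj).
have fin := finitely_many_crossings D (valP e) (valP f) nef.
have ev := evenD (valP e) (valP f) nef.
pose F := [seq p.1 | p <- fset_set (crossings D (val e) (val f))].
have cP p : p \in fset_set (crossings D (val e) (val f)) <->
    lo e f < p.1 < hi e f /\ p.2 = y e p.1 /\ p.2 = y f p.1.
  rewrite in_fset_set // inE /crossings.
  split=> [[/interiorP[/andP[h1 h2] h3] /interiorP[/andP[h4 h5] h6]]|].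
    by rewrite gt_max lt_min h1 h2 h4 h5.
  rewrite gt_max lt_min => -[/andP[/andP[h1 h2] /andP[h3 h4]] [h5 h6]].
  by split; apply/interiorP; rewrite ?h1 ?h2 ?h3 ?h4.
have uF : uniq F.
  rewrite map_inj_in_uniq ?fset_uniq // => p q /cP[_ [p2 _]] /cP[_ [q2 _]] pq.
  by rewrite (surjective_pairing p) (surjective_pairing q) p2 q2 pq.
pose d t := y e t - y f t.
have cd : continuous d.
  by move=> t; apply: cvgB; apply: (curve_continuous DA).
have FP z : z \in F <-> lo e f < z < hi e f /\ d z = 0.
  split=> [/mapP[p /cP[h [p2 p2']] ->]|[h dz]].
    by split=> //; rewrite /d -p2 -p2' subrr.
  apply/mapP; exists (z, y e z) => //; apply/cP; split=> //=; split=> //.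
  by apply/eqP; rewrite -subr_eq0; apply/eqP.
have change z : z \in F ->
    ((\forall t \near z^'-, d t < 0) /\ (\forall t \near z^'+, 0 < d t)) \/
    ((\forall t \near z^'-, 0 < d t) /\ (\forall t \near z^'+, d t < 0)).
  move=> /FP[zin dz]; pose p := (z, y e z).
  have h : lo e f < p.1 < hi e f /\ p.2 = y e p.1 /\ p.2 = y f p.1.
    by split=> //; split=> //=; apply/eqP; rewrite -subr_eq0; apply/eqP.
  have := proj2 (cP p) h; rewrite in_fset_set // inE => -[pe pf].
  have := crossings_proper (valP e) (valP f) nef pe pf.
  rewrite !(arc_curve DA) => /(cross_sign (curve_continuous DA f) (curve_continuous DA e)).
  have /interiorP[pf1 pf2] := pf => /(_ pf1 pf2).
  case=> -[k1 k2]; [left|right]; split.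
  - by apply: filterS k1 => t; rewrite /d subr_lt0.
  - by apply: filterS k2 => t; rewrite /d subr_gt0.
  - by apply: filterS k1 => t; rewrite /d subr_gt0.
  - by apply: filterS k2 => t; rewrite /d subr_lt0.
have := even_sign cd ov uF FP change; rewrite size_map => /(_ ev).
case=> -[k1 k2]; [left|right]; split.
- by apply: filterS k1 => t; rewrite /d subr_lt0.
- by apply: filterS k2 => t; rewrite /d subr_lt0.
- by apply: filterS k1 => t; rewrite /d subr_gt0.
- by apply: filterS k2 => t; rewrite /d subr_gt0.
Qed.

Definition below e f := (e != f) && `[< \forall t \near (lo e f)^'+, y e t < y f t >].
Definition under e v := y e (x v) < (pos D v).2.

Lemma near_asym {F : set_system R} {FF : ProperFilter F} e f :
  (\forall t \near F, y e t < y f t) -> (\forall t \near F, y f t < y e t) -> False.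
Proof.
move=> h1 h2; have [t [/= t1 t2]] := @filter_ex _ F FF _ (filterI h1 h2).
by have := lt_trans t1 t2; rewrite ltxx.
Qed.

Lemma below_hi e f : e != f -> overlap l r x e f ->
  below e f <-> \forall t \near (hi e f)^'-, y e t < y f t.
Proof.
move=> ef ov; rewrite /below ef /=; split.
  move=> /asboolP h; case: (dichotomy ef ov) => -[h1 h2] //.
  by case: (near_asym h h1).
by move=> h; apply/asboolP; case: (dichotomy ef ov) => -[h1 h2] //; case: (near_asym h h2).
Qed.

Lemma below_right_iff e f : l e = l f ->
  below e f <-> \forall t \near (x (l e))^'+, y e t < y f t.
Proof.
move=> ef; rewrite /below /lo -ef maxxx; split=> [/andP[_ /asboolP]//|h].
apply/andP; split; last exact/asboolP.
by apply/eqP => e_f; move: h; rewrite e_f => h; case: (near_asym h h).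
Qed.

Lemma below_left_iff e f : r e = r f ->
  below e f <-> \forall t \near (x (r e))^'-, y e t < y f t.
Proof.
move=> ef; have [e_f|ne] := eqVneq e f.
  rewrite -e_f /below eqxx; split=> // h; by case: (near_asym h h).
have ov : overlap l r x e f by rewrite /overlap -ef lr ef lr.
by rewrite (below_hi ne ov) /hi -ef minxx.
Qed.

(** If [u] is the left endpoint of [f], the overlap with [e] begins at [u] and [e]
is on one side of [u] there; if it is the right endpoint, the overlap ends at
[u], and [dichotomy] brings the sign back to its beginning. *)
Lemma even_below : even_signs l r x below under.
Proof.
have anti e f : e != f -> overlap l r x e f -> below f e = ~~ below e f.
  move=> ef ov; rewrite /below ef eq_sym ef /= /lo [Num.max (x (l f)) _]maxC -/(lo e f).
  case: (dichotomy ef ov) => -[h1 _].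
    by rewrite [X in ~~ X]asboolT // asboolF // => h2; exact: near_asym h1 h2.
  by rewrite asboolT // asboolF // => h2; exact: near_asym h1 h2.
split=> //.
- by move=> e; rewrite /below eqxx.
- move=> e f u uf eu; have ef := spans_end_neq eu uf.
  have ov : overlap l r x e f := spans_overlap lr eu uf.
  have yf : y f (x u) = (pos D u).2 by apply: curve_end.
  have cmp (q q' : edge G) : y q (x u) < y q' (x u) -> \forall t \near x u, y q t < y q' t.
    move=> h; have cq : continuous (fun t => y q' t - y q t).
      by move=> t; apply: cvgB; apply: (curve_continuous DA).
    rewrite -subr_gt0 in h.
    have hn : \forall t \near x u, 0 < y q' t - y q t.
      exact: (@cvgr_gt R R (nbhs (x u)) _ _ _ (cq (x u)) 0 h).
    apply: filterS hn => t.
    by rewrite subr_gt0.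
  have side (q q' : edge G) : q != q' -> overlap l r x q q' ->
      lo q q' = x u \/ hi q q' = x u -> y q (x u) < y q' (x u) -> below q q'.
    move=> qq ov' [] h /cmp nn; last by apply/(below_hi qq ov'); rewrite h; apply: near_at_left.
    by rewrite /below qq; apply/asboolP; rewrite h; apply: near_at_right.
  have loE : lo e f = x u \/ hi e f = x u.
    move: eu => /andP[eu1 eu2].
    case/orP: uf => /eqP uE; [left|right]; rewrite /lo /hi -uE; [apply/max_idPr|apply/min_idPr];
      exact: ltW.
  have : y e (x u) != y f (x u).
    apply/eqP => h; have : Defs.arc D (val e) (pos D u).
      rewrite (arc_curve DA); split; last by rewrite -/(xpos D u) -/x h yf.
      by case/andP: eu => *; rewrite !ltW.
    move=> /(arc_avoids_vertices (valP e)); rewrite mem_edge.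
    by move=> /orP[]/eqP uE; move: eu; rewrite /spans uE ltxx ?andbF.
  rewrite /under -yf; case: ltgtP => // h _.
    exact: side ef ov loE h.
  apply/negbTE; rewrite -(anti _ _ ef ov); apply: side h.
  - by rewrite eq_sym.
  - by move: ov; rewrite /overlap andbC.
  - by rewrite /lo /hi [Num.max (x (l f)) _]maxC [Num.min (x (r f)) _]minC.
- move=> e f q ef fq /(below_right_iff ef) h1 /(below_right_iff fq) h2.
  have eq : l e = l q by rewrite ef.
  apply/(below_right_iff eq); rewrite -ef in h2.
  by apply: filterS2 h1 h2 => t; apply: lt_trans.
- move=> e f q ef fq /(below_left_iff ef) h1 /(below_left_iff fq) h2.
  have eq : r e = r q by rewrite ef.
  apply/(below_left_iff eq); rewrite -ef in h2.
  by apply: filterS2 h1 h2 => t; apply: lt_trans.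
Qed.
End Local.
End Drawn.

(** * The crossing-free drawing *)

Definition edge_of (G : sgraph) (S : {set G}) (SE : S \in edges G) : edge G :=
  exist _ S SE.

Section Build.
Variables (R : realType) (G : sgraph) (l r : edge G -> G) (x : G -> R).
Hypothesis x_inj : injective x.
Hypothesis lr : forall e, x (l e) < x (r e).
Hypothesis ends : forall e, val e = [set l e; r e]%SET.
Variables (s : edge G -> edge G -> bool) (A : edge G -> G -> bool).
Hypothesis evenS : even_signs l r x s A.
Hypothesis good : forall v, level_good l r x s A v.
Implicit Types (e f g : edge G) (u v : G) (t : R).

Definition rank v : nat := #|[pred g | spans l r x g v && A g v]|.
(** The rank of [e] among the edges over [v] and [v] itself.  At its endpoints an
edge has the rank of the vertex. *)
Definition height e v : nat :=
  if spans l r x e v then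
    (#|[pred g | spans l r x g v && s g e]| + ~~ A e v)%N
  else rank v.

Lemma height_lt e f v : spans l r x e v -> spans l r x f v -> s e f ->
  (height e v < height f v)%N.
Proof.
move=> ve vf ef; have [tr mono] := good v.
rewrite /height ve vf.
have lev q : spans l r x q v -> x (l q) <= x v < x (r q).
  by move=> /andP[h1 h2]; rewrite ltW.
have lt : (#|[pred g | spans l r x g v && s g e]| < #|[pred g | spans l r x g v && s g f]|)%N.
  apply: proper_card; apply/properP; split.
    apply/fintype.subsetP => q; rewrite !inE => /andP[vq qe]; rewrite vq /=.
    exact: (tr _ _ _ (lev _ vq) (lev _ ve) (lev _ vf) qe ef).
  by exists e; rewrite !inE ve ?ef // (sign_irr evenS).
have : (~~ A e v <= ~~ A f v)%N.
  by case Af: (A f v) => //=; [rewrite (mono e f)|case: (A e v)].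
lia.
Qed.

Lemma height_lt_vertex e v : spans l r x e v -> A e v -> (height e v < rank v)%N.
Proof.
move=> ve Ae; have [_ mono] := good v; rewrite /height ve Ae addn0.
apply: proper_card; apply/properP; split.
  apply/fintype.subsetP => q; rewrite !inE => /andP[vq qe]; rewrite vq /=.
  exact: mono qe Ae.
by exists e; rewrite !inE ve ?Ae // (sign_irr evenS).
Qed.

Lemma height_gt_vertex e v : spans l r x e v -> ~~ A e v -> (rank v < height e v)%N.
Proof.
move=> ve nAe; have [_ mono] := good v; rewrite /height ve nAe addn1 ltnS.
apply: subset_leq_card; apply/fintype.subsetP => q; rewrite !inE => /andP[vq Aq]; rewrite vq /=.
have qe : e != q by apply/eqP => eq; rewrite eq Aq in nAe.
have ov : overlap l r x e q.
  move: ve vq => /andP[h1 h2] /andP[h3 h4].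
  by rewrite /overlap (lt_trans h1 h4) (lt_trans h3 h2).
rewrite (sign_anti evenS qe ov); apply: contraNN nAe => eq; exact: mono eq Aq.
Qed.

Lemma height_end e v : is_end l r v e -> height e v = rank v.
Proof.
move=> ve; rewrite /height; case: ifP => // /andP[].
by case/orP: ve => /eqP->; rewrite ltxx.
Qed.

Lemma span_or_end e v : x (l e) <= x v <= x (r e) -> spans l r x e v \/ is_end l r v e.
Proof.
rewrite !le_eqVlt => /andP[/predU1P[/x_inj<-|h1] h2]; first by right; rewrite is_endl.
case/predU1P: h2 => [/x_inj->|h2]; first by right; rewrite is_endr.
by left; apply/andP.
Qed.

(** The equality case is what makes the curves disjoint: heights at a common level
differ unless both edges end there. *)
Lemma height_le e f v : s e f ->
  x (l e) <= x v <= x (r e) -> x (l f) <= x v <= x (r f) ->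
  (height e v <= height f v)%N /\
  (height e v = height f v -> is_end l r v e /\ is_end l r v f).
Proof.
move=> ef /span_or_end[ve|ve] /span_or_end[vf|vf].
- by have h := height_lt ve vf ef; split; [exact: ltnW|move=> hE; rewrite hE ltnn in h].
- rewrite (height_end vf); have h := height_lt_vertex ve; move: h.
  rewrite -(sign_end evenS vf ve) => /(_ ef) h.
  by split; [exact: ltnW|move=> hE; rewrite hE ltnn in h].
- rewrite (height_end ve); have h := height_gt_vertex vf; move: h.
  rewrite -(sign_endC lr evenS ve vf) => /(_ ef) h.
  by split; [exact: ltnW|move=> hE; rewrite -hE ltnn in h].
- by rewrite !height_end.
Qed.

(** A continuous bump, positive exactly between the vertices preceding and following
[v] in abscissa: each other vertex contributes a factor that vanishes beyond it. *)
Definition hat v t : R :=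
  (\prod_(u | x u < x v) Num.max 0 (t - x u)) * \prod_(u | x v < x u) Num.max 0 (x u - t).

Lemma hat_ge0 v t : 0 <= hat v t.
Proof. by rewrite mulr_ge0 // prodr_ge0 // => u _; rewrite le_max lexx. Qed.

Lemma hat_gt0P v t : reflect
  ((forall u, x u < x v -> x u < t) /\ (forall u, x v < x u -> t < x u)) (0 < hat v t).
Proof.
apply: (iffP idP) => [|[h1 h2]]; last first.
  by rewrite mulr_gt0 // prodr_gt0 // => u uv; rewrite lt_max subr_gt0 ?h1 ?h2 ?orbT.
move=> h; have : hat v t != 0 by rewrite gt_eqF.
rewrite mulf_eq0 negb_or => /andP[/prodf_neq0 h1 /prodf_neq0 h2].
split=> u uv.
  by have := h1 u uv; rewrite -subr_gt0; apply: contraNT; rewrite -leNgt => /max_idPl->.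
by have := h2 u uv; rewrite -[_ < x u]subr_gt0; apply: contraNT; rewrite -leNgt => /max_idPl->.
Qed.

Lemma hat_self v : 0 < hat v (x v). Proof. by apply/hat_gt0P. Qed.

Lemma hat_other u v : u != v -> hat u (x v) = 0.
Proof.
move=> uv; apply/eqP; apply: contraT => h.
have /hat_gt0P[h1 h2] : 0 < hat u (x v) by rewrite lt_neqAle eq_sym h hat_ge0.
case: (ltgtP (x u) (x v)) => [/h2|/h1|/x_inj]; rewrite ?ltxx //.
by move=> e; rewrite e eqxx in uv.
Qed.

Lemma hat_continuous v : continuous (hat v).
Proof.
have cmax (F : R -> R) : continuous F -> continuous (fun t => Num.max 0 (F t)).
  move=> cF t; apply: (@continuous_max R R (fun=> 0) F); first exact: cvg_cst.
  exact: cF.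
have cprod (P : pred G) (F : G -> R -> R) : (forall u, continuous (F u)) ->
    continuous (fun t => \prod_(u | P u) F u t).
  by move=> cF; apply: continuous_big => //; exact: mul_continuous.
have cid : continuous (id : R -> R) by move=> t; exact: cvg_id.
have cst c : continuous ((fun=> c) : R -> R) by move=> t; exact: cvg_cst.
move=> t; apply: cvgM; apply: cprod => u {}t; apply: cmax => {}t.
  by apply: cvgB; [exact: cid|exact: cst].
by apply: cvgB; [exact: cst|exact: cid].
Qed.

Definition curve e t : R := \sum_v (height e v)%:R * hat v t.

Lemma curve_cont e : continuous (curve e).
Proof.
apply: continuous_big => [|v _]; first exact: add_continuous.
by move=> t; apply: cvgM; [exact: cvg_cst|exact: hat_continuous].
Qed.

Lemma curve_vertex e v : curve e (x v) = (height e v)%:R * hat v (x v).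
Proof.
rewrite /curve (bigD1 v) //= big1 ?addr0 // => u uv.
by rewrite hat_other ?mulr0.
Qed.

(** [hat v] is the only bump that does not vanish at [x v]. *)
Definition place v : R * R := (x v, (rank v)%:R * hat v (x v)).

Lemma curve_place e v : is_end l r v e -> curve e (x v) = (place v).2.
Proof. by move=> ve; rewrite curve_vertex height_end. Qed.

Lemma curve_avoid e v : spans l r x e v -> curve e (x v) <> (place v).2.
Proof.
move=> ve; rewrite curve_vertex /= => /(mulIf (lt0r_neq0 (hat_self v)))/eqP.
rewrite eqr_nat => /eqP hE; case Ae: (A e v).
  by have := height_lt_vertex ve Ae; rewrite hE ltnn.
by have := height_gt_vertex ve (negbT Ae); rewrite hE ltnn.
Qed.

Lemma hat_between e v t : x (l e) <= t <= x (r e) -> 0 < hat v t ->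
  x (l e) <= x v <= x (r e).
Proof.
move=> /andP[h1 h2] /hat_gt0P[h3 h4]; apply/andP; split; rewrite leNgt; apply/negP.
  by move=> /h4; rewrite ltNge h1.
by move=> /h3; rewrite ltNge h2.
Qed.

Lemma no_parallel e f : l e = l f -> r e = r f -> e = f.
Proof. by move=> h1 h2; apply: val_inj; rewrite !ends h1 h2. Qed.

Lemma left_end e v t : is_end l r v e -> x v < t <= x (r e) -> v = l e.
Proof. by move=> /orP[]/eqP-> // /andP[h1 h2]; have := lt_le_trans h1 h2; rewrite ltxx. Qed.

Lemma right_end e v t : is_end l r v e -> x (l e) <= t < x v -> v = r e.
Proof. by move=> /orP[]/eqP-> // /andP[h1 h2]; have := le_lt_trans h1 h2; rewrite ltxx. Qed.

(** The difference of the curves at [t] is a combination with nonnegative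
coefficients of the bumps of the levels around [t].  One of these coefficients
is positive, for otherwise both edges would end at [t] or join the two levels
around [t]. *)
Lemma curve_lt e f t : e != f -> s e f ->
  x (l e) <= t <= x (r e) -> x (l f) <= t <= x (r f) ->
  (forall v, is_end l r v e -> is_end l r v f -> t != x v) ->
  curve e t < curve f t.
Proof.
move=> nef ef te tf nend.
have term v : 0 <= ((height f v)%:R - (height e v)%:R) * hat v t.
  have [h|h] := ltP 0 (hat v t); last first.
    have -> : hat v t = 0 by apply: le_anti; rewrite h hat_ge0.
    by rewrite mulr0.
  have [h1 _] := height_le ef (hat_between te h) (hat_between tf h).
  by rewrite mulr_ge0 ?hat_ge0 // subr_ge0 ler_nat.
suff [v [h nv]] : exists v, 0 < hat v t /\ ~ (is_end l r v e /\ is_end l r v f).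
  rewrite -subr_gt0 /curve -sumrB (eq_bigr (fun v => ((height f v)%:R - (height e v)%:R) * hat v t));
    last by move=> u _; rewrite mulrBl.
  rewrite (bigD1 v) //= ltr_wpDr ?sumr_ge0 // mulr_gt0 // subr_gt0 ltr_nat.
  have [h1 h2] := height_le ef (hat_between te h) (hat_between tf h).
  by rewrite ltn_neqAle h1 andbT; apply/eqP => /h2.
case/andP: (te) => te1 te2; case/andP: (tf) => tf1 tf2.
(* [v0] and [v1] are the levels around [t]; they coincide if [t] is a level *)
case: (Order.TotalTheory.arg_maxP (P := fun u => x u <= t) x te1) => v0 v0t max0.
have max u : x u <= t -> x u <= x v0 by exact: max0.
case: (Order.TotalTheory.arg_minP (P := fun u => t <= x u) x te2) => v1 v1t min0.
have min u : t <= x u -> x v1 <= x u by exact: min0.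
have h0 : 0 < hat v0 t.
  apply/hat_gt0P; split=> u uv; first exact: lt_le_trans uv v0t.
  by rewrite ltNge; apply/negP => /max; rewrite leNgt uv.
have h1 : 0 < hat v1 t.
  apply/hat_gt0P; split=> u uv; last exact: le_lt_trans v1t uv.
  by rewrite ltNge; apply/negP => /min; rewrite leNgt uv.
have [/andP[e0 f0]|n0] := boolP (is_end l r v0 e && is_end l r v0 f); last first.
  by exists v0; split=> // /andP; apply/negP.
have [/andP[e1 f1]|n1] := boolP (is_end l r v1 e && is_end l r v1 f); last first.
  by exists v1; split=> // /andP; apply/negP.
have v0t' : x v0 < t by rewrite lt_neqAle eq_sym nend.
have v1t' : t < x v1 by rewrite lt_neqAle nend.
exfalso; move/eqP: nef; apply; apply: no_parallel.
  by rewrite -(left_end e0 (t := t)) ?v0t' // -(left_end f0 (t := t)) ?v0t'.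
by rewrite -(right_end e1 (t := t)) ?te1 // -(right_end f1 (t := t)) ?tf1.
Qed.

(** Arcs are indexed by sets of vertices, curves by edges. *)
Definition new_arc (S : {set G}) : set (R * R) :=
  [set p | exists2 e, val e = S & graph_on (x (l e)) (x (r e)) (curve e) p].

Lemma new_arcE e : new_arc (val e) = graph_on (x (l e)) (x (r e)) (curve e).
Proof.
by apply/seteqP; split=> [p [f /val_inj-> //]|p pe]; exists e.
Qed.

Lemma mem_ends e v : (v \in val e) = is_end l r v e.
Proof. by rewrite ends !inE. Qed.

Lemma mem_edges u v : adj u v -> [set u; v]%SET \in edges G.
Proof.
move=> uv; rewrite inE; apply/existsP; exists u; apply/existsP; exists v.
by rewrite uv eqxx.
Qed.

Lemma segment_arc (y : R -> R) a b : continuous y -> a != b ->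
  jordan_arc (a, y a) (b, y b) (graph_on (Num.min a b) (Num.max a b) y).
Proof.
move=> cy ab; pose lin t := a + t * (b - a).
exists (fun t => (lin t, y (lin t))).
have clin : continuous lin.
  move=> t; apply: cvgD; first exact: cvg_cst.
  by apply: cvgM; [exact: cvg_id|exact: cvg_cst].
split.
- apply: continuous_subspaceT; apply: pair_continuous => // t.
  by apply: continuous_comp; [exact: clin|exact: cy].
- move=> t t' _ _ [] /addrI/mulIf; rewrite subr_eq0 eq_sym => /(_ ab) //.
- by rewrite /lin mul0r addr0.
- by rewrite /lin mul1r addrC subrK.
- apply/seteqP; split=> [p [t]|[z w] [/= zab ->]].
    rewrite /= in_itv /= => /andP[t0 t1] <-; split=> //=; rewrite /lin.
    by case: (leP a b) => h; apply/andP; split; nra.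
  exists ((z - a) / (b - a)); last first.
    by rewrite /lin divfK ?subr_eq0 1?eq_sym // addrC subrK.
  rewrite /= in_itv /=; move: zab; case: (ltgtP a b) ab => // h _ /andP[h1 h2].
    by rewrite divr_ge0 ?ler_pdivrMr /= ?subr_ge0 ?subr_gt0 ?mul1r ?lerD2r ?h1 ?h2 ?ltW.
  rewrite -(opprB a z) -(opprB a b) invrN mulrNN.
  by rewrite divr_ge0 ?ler_pdivrMr /= ?subr_ge0 ?subr_gt0 ?mul1r ?lerD2l ?lerN2 ?h1 ?h2 ?ltW.
Qed.

Lemma new_joins u v : adj u v -> jordan_arc (place u) (place v) (new_arc [set u; v]%SET).
Proof.
move=> uv; have nuv : u != v by apply/eqP => h; move: uv; rewrite h adj_irrefl.
pose e : edge G := edge_of (mem_edges uv).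
have ue : is_end l r u e by rewrite -mem_ends /= !inE eqxx.
have ve : is_end l r v e by rewrite -mem_ends /= !inE eqxx orbT.
rewrite -[[set u; v]%SET]/(val e) new_arcE.
have xuv : x u != x v by rewrite (inj_eq x_inj).
have := segment_arc (curve_cont (e := e)) xuv.
rewrite !curve_place // /place /=.
suff [-> ->] : Num.min (x u) (x v) = x (l e) /\ Num.max (x u) (x v) = x (r e) by [].
have := ltW (lr e); move: ue ve nuv => /orP[]/eqP-> /orP[]/eqP->; rewrite ?eqxx // => _ h.
  by split; [exact/min_idPl|exact/max_idPr].
by split; [exact/min_idPr|exact/max_idPl].
Qed.

Lemma new_avoids (S : {set G}) v : S \in edges G -> new_arc S (place v) -> v \in S.
Proof.
move=> SE [e <- [/= xv yv]]; rewrite mem_ends.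
by case: (span_or_end xv) => // /curve_avoid; rewrite /= yv.
Qed.

Lemma new_interior (S : {set G}) p : arc_interior place new_arc S p -> exists e,
  [/\ val e = S, x (l e) <= p.1 <= x (r e), p.2 = curve e p.1 &
      forall v, is_end l r v e -> p.1 != x v].
Proof.
move=> [[e eS [p1 p2]] np]; exists e; split=> // v ve; apply/eqP => pv; apply: np.
exists v; first by rewrite /= -eS mem_ends.
by rewrite (surjective_pairing p) p2 pv (curve_place ve).
Qed.

Lemma new_disjoint (S T : {set G}) : S != T ->
  arc_interior place new_arc S `&` arc_interior place new_arc T = set0.
Proof.
move=> ST; apply/seteqP; split=> // p [/new_interior[e [eS pe ye ne]] /new_interior[f [fT pf yf nf]]].
have ef : e != f by apply/eqP => h; move: ST; rewrite -eS -fT h eqxx.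
have ov : overlap l r x e f.
  have strict g : x (l g) <= p.1 <= x (r g) -> (forall v, is_end l r v g -> p.1 != x v) ->
      x (l g) < p.1 < x (r g).
    move=> /andP[h1 h2] ng; rewrite !lt_neqAle h1 h2 !andbT eq_sym !ng ?is_endl ?is_endr //.
  move: (strict e pe ne) (strict f pf nf) => /andP[h1 h2] /andP[h3 h4].
  by rewrite /overlap (lt_trans h1 h4) (lt_trans h3 h2).
have : curve e p.1 = curve f p.1 by rewrite -ye -yf.
case sef : (s e f).
  by have := @curve_lt e f p.1 ef sef pe pf (fun v ve _ => ne v ve); move=> /lt_eqF/eqP.
have sfe : s f e by rewrite (sign_anti evenS ef ov) sef.
have fe : f != e by rewrite eq_sym.
by have := @curve_lt f e p.1 fe sfe pf pe (fun v vf _ => nf v vf); move=> /lt_eqF/eqP h /esym.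
Qed.

Definition new_drawing : drawing R G.
Proof.
apply: (@Drawing R G place new_arc).
- exact: new_joins.
- exact: new_avoids.
- by move=> e f _ _ /new_disjoint->; exact: finite_set0.
- by move=> e f h _ _ _ /new_disjoint-> _ _; rewrite set0I.
- move=> e f p _ _ /new_disjoint ef pe pf.
  by have : (arc_interior place new_arc e `&` arc_interior place new_arc f) p by []; rewrite ef.
- exact: x_inj.
Defined.

Lemma new_drawn_as : drawn_as new_drawing l r curve.
Proof.
split.
- exact: lr.
- exact: ends.
- exact: curve_cont.
- by move=> e; apply: curve_place; rewrite is_endl.
- by move=> e; apply: curve_place; rewrite is_endr.
- exact: new_arcE.
Qed.

Lemma new_crossing_free : crossing_free new_drawing.
Proof. by move=> e f _ _; exact: new_disjoint. Qed.

Lemma new_monotone : x_monotone new_drawing.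
Proof.
move=> S SE t u w; rewrite [Defs.arc _ S](new_arcE (edge_of SE)).
exact: graph_on_fun.
Qed.

(** At a common endpoint the order of the new curves is given by the signs, hence
is that of the original drawing as soon as these signs were kept. *)
Lemma new_below_left e f : r e = r f ->
  (\forall t \near (x (r e))^'-, curve e t < curve f t) <-> s e f.
Proof.
move=> ef.
have sub g h : r g = r h -> s g h -> \forall t \near (x (r g))^'-, curve g t < curve h t.
  move=> gh sgh; have ngh : g != h by apply: contraTneq sgh => ->; rewrite (sign_irr evenS).
  apply/near_leftP; exists (Num.max (x (l g)) (x (l h))).
    by rewrite gt_max lr gh lr.
  move=> t; rewrite gt_max => /andP[/andP[t1 t2] t3].
  apply: curve_lt => //; rewrite ?(ltW t1) ?(ltW t2) -?gh ?ltW //.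
  move=> v /orP[]/eqP-> _; first by rewrite gt_eqF.
  by rewrite lt_eqF.
split=> [h|]; last exact: sub.
have [e_f|ne] := eqVneq e f; first by rewrite e_f in h; case: (near_asym h h).
have ov : overlap l r x e f by rewrite /overlap -ef lr ef lr.
apply: contraT => /negbTE nsef; have sfe : s f e by rewrite (sign_anti evenS ne ov) nsef.
by have := sub f e (esym ef) sfe; rewrite -ef => /(near_asym h).
Qed.

Lemma new_below_right e f : l e = l f ->
  (\forall t \near (x (l e))^'+, curve e t < curve f t) <-> s e f.
Proof.
move=> ef.
have sub g h : l g = l h -> s g h -> \forall t \near (x (l g))^'+, curve g t < curve h t.
  move=> gh sgh; have ngh : g != h by apply: contraTneq sgh => ->; rewrite (sign_irr evenS).
  apply/near_rightP; exists (Num.min (x (r g)) (x (r h))).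
    by rewrite lt_min lr gh lr.
  move=> t; rewrite lt_min => /andP[t3 /andP[t1 t2]].
  apply: curve_lt => //; rewrite ?(ltW t1) ?(ltW t2) -?gh ?ltW //.
  move=> v /orP[]/eqP-> _; first by rewrite gt_eqF.
  by rewrite lt_eqF.
split=> [h|]; last exact: sub.
have [e_f|ne] := eqVneq e f; first by rewrite e_f in h; case: (near_asym h h).
have ov : overlap l r x e f by rewrite /overlap -ef lr ef lr.
apply: contraT => /negbTE nsef; have sfe : s f e by rewrite (sign_anti evenS ne ov) nsef.
by have := sub f e (esym ef) sfe; rewrite -ef => /(near_asym h).
Qed.
End Build.

Theorem theorem1 (R : realType) (G : sgraph) (D : drawing R G) :
  connected_graph G -> x_monotone D -> even_drawing D ->
  exists D' : drawing R G,
    [/\ x_monotone D',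
        equivalent_drawings D D',
        crossing_free D'
      & forall v : G, (pos D' v).1 = (pos D v).1].
Proof.
move=> conG mono ev.
have [l [r [y DA]]] := monotone_drawn_as mono.
pose x := xpos D.
have x_inj : injective x := @vertex_abscissae_inj _ _ D.
have lr e : x (l e) < x (r e) := ends_lt DA e.
have conE u w : connect (edge_adj l r) u w.
  apply: connect_sub (conG u w) => {}u {}w uw; apply: connect1.
  apply/existsP; exists (edge_of (mem_edges uw) : edge G).
  by rewrite -!(mem_edge DA) /= !inE !eqxx orbT.
have [s [A [evenS ag good]]] := level_planar x_inj lr conE (even_below DA ev).
pose D' := new_drawing x_inj lr (ends_set DA) evenS good.
have DA' : drawn_as D' l r _ := new_drawn_as x_inj lr (ends_set DA) evenS good.
exists D'; split=> //.
- exact: new_monotone.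
- split=> [v S SE vS|v S T SE TE vS vT side].
    pose e : edge G := edge_of SE.
    rewrite -[S]/(val e) in vS *.
    by split; [rewrite (leaves_leftP DA vS) (leaves_leftP DA' vS)|
               rewrite (leaves_rightP DA vS) (leaves_rightP DA' vS)].
  pose e : edge G := edge_of SE; pose f : edge G := edge_of TE.
  rewrite -[S]/(val e) -[T]/(val f) in vS vT side *.
  case: side => -[].
    move=> /(leaves_leftP DA vS) ve /(leaves_leftP DA vT) vf.
    rewrite (below_left DA ve vf) (below_left DA' ve vf).
    have ef : r e = r f by rewrite -ve.
    have h1 := below_left_iff DA ev ef.
    have h2 := new_below_left x_inj lr (ends_set DA) evenS good ef.
    rewrite (ag e f (or_intror ef)) in h2.
    by rewrite ve; exact: iff_trans (iff_sym h1) (iff_sym h2).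
  move=> /(leaves_rightP DA vS) ve /(leaves_rightP DA vT) vf.
  rewrite (below_right DA ve vf) (below_right DA' ve vf).
  have ef : l e = l f by rewrite -ve.
  have h1 := below_right_iff D y ef.
  have h2 := new_below_right x_inj lr (ends_set DA) evenS good ef.
  rewrite (ag e f (or_introl ef)) in h2.
  by rewrite ve; exact: iff_trans (iff_sym h1) (iff_sym h2).
- exact: new_crossing_free.
Qed.
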